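(* Let $(\mathcal{X},d)$ be a nonempty metric space, $T>0$, $\mathcal{Q}=\mathcal{X}\times(0,T)$, $\mathbf{R}_+=[0,\infty)$. Let $H:\mathcal{X}\times\mathbf{R}_+\to\mathbf{R}$, put $L(x,v)=\sup_{p\in\mathbf{R}_+}(pv-H(x,p))\in\mathbf{R}\cup\{\infty\}$ for $(x,v)\in\mathcal{X}\times\mathbf{R}_+$, and assume: (1) $H$ is continuous on $\mathcal{X}\times\mathbf{R}_+$; (2) $p\mapsto H(x,p)$ is convex and nondecreasing for each $x\in\mathcal{X}$; (3) $\sup_{x\in\mathcal{X}}H(x,p)<\infty$ for each $p\in\mathbf{R}_+$; (4) $\inf_{x\in\mathcal{X}}H(x,0)>-\infty$ and $\liminf_{p\to\infty}\inf_{x\in\mathcal{X}}H(x,p)/p>0$; (5) $L$ is continuous on $D_L:=\{(x,v)\in\mathcal{X}\times\mathbf{R}_+\mid L(x,v)<\infty\}$, and $x\mapsto\sup\{v\in\mathbf{R}_+\mid (x,v)\in D_L\}\in[0,\infty]$ is lower semicontinuous on $\mathcal{X}$. Let $u_0:\mathcal{X}\to\mathbf{R}$ be bounded and uniformly continuous. Define the value function $$U(x,t)=\inf_{\xi\in\mathcal{A}_x(\mathcal{X})}\left\{\int_0^t L(\xi(r),|\xi'|(r))\,dr+u_0(\xi(t))\right\},\qquad (x,t)\in\mathcal{X}\times[0,T].$$ Then $U$ (restricted to $\mathcal{X}\times[0,T)$) is a solution of the initial value problem $$u_t+H(x,|Du|)=0\ \text{ in }\mathcal{X}\times(0,T),\qquad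 u|_{t=0}=u_0\ \text{ on }\mathcal{X},$$ and it is the only solution.
   Context: Curves. $AC(I,\mathcal{X})$ is the set of curves $\xi:I\to\mathcal{X}$ on an interval $I\subset\mathbf{R}$ that are absolutely continuous (on every compact subinterval of $I$); such a curve has, for a.e. $t$, a metric derivative $|\xi'|(t)=\lim_{s\to t}d(\xi(s),\xi(t))/|s-t|$. A curve $\xi\in AC([0,\infty),\mathcal{X})$ is admissible, $\xi\in\mathcal{A}(\mathcal{X})$, if there are finitely many points $0<r_1<\dots<r_n$ such that on each of the intervals $I=[0,r_1],[r_1,r_2],\dots,[r_n,\infty)$ the metric derivative $|\xi'|$ equals (a.e.) a constant $v_I\in\mathbf{R}_+$ and $r\mapsto L(\xi(r),v_I)$ is a (finite-valued) continuous function on $I$. $\mathcal{A}_x(\mathcal{X})=\{\xi\in\mathcal{A}(\mathcal{X})\mid \xi(0)=x\}$. For admissible $\xi$, $|\xi'|(h+0)$ denotes the constant value of $|\xi'|$ immediately to the right of $h$. One-sided differentials. For a real function $w$ on an interval $I\subset\mathbf{R}$ and $h\in I$: $D^{+,r}w(h)$ (resp. $D^{-,r}w(h)$) is the set of right derivatives $\varphi'(h+0)$ where, for some $r>0$, $\varphi$ is piecewise $C^1$ on $[h,h+r)$ (continuous, and $C^1$ up to the endpoints on each of finitely many subintervals) and $w-\varphi$ attains its maximum (resp. minimum) over $[h,h+r)$ at $h$. Arcwise continuity. A function $u:\mathcal{X}\times J\to\mathbf{R}$ ($J=(0,T)$ or $[0,T)$) is arcwise continuous if for every $\xi\in AC(\mathbf{R},\mathcal{X})$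 the function $(s,t)\mapsto u(\xi(s),t)$ is continuous on $\mathbf{R}\times J$. Subsolution. An arcwise continuous $u$ on $\mathcal{Q}$ is a subsolution of $u_t+H(x,|Du|)=0$ if for each $(x,t)\in\mathcal{Q}$ and every $\xi\in\mathcal{A}_x(\mathcal{X})$, with $w(h):=u(\xi(h),t-h)$, one has $-p\le L(\xi(h),|\xi'|(h+0))$ for all $p\in D^{+,r}w(h)$ and all $h\in[0,t)$. Supersolution. An arcwise continuous $u$ on $\mathcal{Q}$ is a supersolution if for each $(x,t)\in\mathcal{Q}$ and $\varepsilon>0$ there exist $\xi\in\mathcal{A}_x(\mathcal{X})$ and a continuous function $w:[0,t)\to\mathbf{R}$ such that $w(0)=u(x,t)$, $w(h)\ge u(\xi(h),t-h)-\varepsilon$ for all $h\in[0,t)$, and $-p\ge L(\xi(h),|\xi'|(h+0))$ for all $p\in D^{-,r}w(h)$ and all $h\in[0,t)$. Solution. A solution of the initial value problem is an arcwise continuous function $u$ on $\mathcal{X}\times[0,T)$ that is both a subsolution and a supersolution (on $\mathcal{Q}$) and satisfies $u(x,0)=u_0(x)$ for all $x\in\mathcal{X}$. (The expression $u_t+H(x,|Du|)=0$ is only formal; its meaning is given by these definitions.) *)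

(* Defs.v *)
From HB Require Import structures.
From mathcomp Require Import all_boot all_order all_algebra.
From mathcomp Require Import all_classical all_reals all_analysis.

Set Implicit Arguments.
Unset Strict Implicit.
Unset Printing Implicit Defensive.

Import Order.TTheory GRing.Theory Num.Theory.
Import numFieldNormedType.Exports.

Local Open Scope classical_set_scope.
Local Open Scope ring_scope.

(* [pieces a [:: c1; ...; cn] b] is the list of consecutive intervals
   [a, c1], [c1, c2], ..., [cn, b]; the bound [b] of the last one may be open
   or infinite. *)
Fixpoint pieces (R : realType) (a : R) (s : seq R) (b : itv_bound R) :
    seq (interval R) :=
  if s is c :: s' then `[a, c] :: pieces c s' b
  else [:: Interval (BLeft a) b].

Section Curves.
Variables (R : realType) (X : metricType R).

(* Curves on I are total functions of which only the values on I matter. *)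
Definition abs_continuous (I : set R) (xi : R -> X) : Prop :=
  forall a b : R, a <= b -> `[a, b] `<=` I ->
  forall e : R, 0 < e -> exists2 d : R, 0 < d &
  forall (n : nat) (l r : 'I_n -> R),
    (forall i, a <= l i /\ l i <= r i /\ r i <= b) ->
    trivIset setT (fun i => `]l i, r i[%classic) ->
    \sum_(i < n) (r i - l i) < d ->
    \sum_(i < n) mdist (xi (l i)) (xi (r i)) < e.

Definition mdiff_quotient (xi : R -> X) (t s : R) : R :=
  mdist (xi s) (xi t) / `|s - t|.

Definition has_metric_derivative (xi : R -> X) (t v : R) : Prop :=
  mdiff_quotient xi t s @[s --> t^'] --> v.

(* Meaningful only where the limit exists, i.e. almost everywhere for an
   absolutely continuous curve. *)
Definition metric_derivative (xi : R -> X) (t : R) : R :=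
  lim (mdiff_quotient xi t s @[s --> t^']).

Definition ae_speed (xi : R -> X) (I : set R) (v : R) : Prop :=
  {ae lebesgue_measure, forall t, I t -> has_metric_derivative xi t v}.

(* |xi'|(h+0); well defined for admissible curves and h >= 0. *)
Definition right_speed (xi : R -> X) (h : R) : R :=
  get [set v | exists2 e : R, 0 < e & ae_speed xi `]h, h + e[ v].

Definition arcwise_continuous (J : set R) (u : X -> R -> R) : Prop :=
  forall xi : R -> X, abs_continuous setT xi ->
  {within [set z : R * R | J z.2], continuous (fun z => u (xi z.1) z.2)}.

End Curves.

Section OneSidedDifferentials.
Variable R : realType.

Definition C1_up_to_ends (J : interval R) (phi : R -> R) : Prop :=
  {within [set` J], continuous phi} /\
  exists2 g : R -> R, {within [set` J], continuous g} &
    forall s, [set` J]° s -> is_derive s 1 phi (g s).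

Definition piecewise_C1 (a b : R) (phi : R -> R) : Prop :=
  {within `[a, b[, continuous phi} /\
  exists s : seq R, [/\ path <%R a s, all (fun c => c < b) s &
    forall J, J \in pieces a s (BLeft b) -> C1_up_to_ends J phi].

Definition has_right_derivative (phi : R -> R) (h p : R) : Prop :=
  (phi s - phi h) / (s - h) @[s --> h^'+] --> p.

Definition right_superdifferential (I : set R) (w : R -> R) (h : R) : set R :=
  [set p | exists (r : R) (phi : R -> R),
    [/\ 0 < r, `[h, h + r[ `<=` I, piecewise_C1 h (h + r) phi,
        has_right_derivative phi h p &
        forall s, h <= s < h + r -> w s - phi s <= w h - phi h]].

Definition right_subdifferential (I : set R) (w : R -> R) (h : R) : set R :=
  [set p | exists (r : R) (phi : R -> R),
    [/\ 0 < r, `[h, h + r[ `<=` I, piecewise_C1 h (h + r) phi,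
        has_right_derivative phi h p &
        forall s, h <= s < h + r -> w h - phi h <= w s - phi s]].

End OneSidedDifferentials.

Section HamiltonJacobi.
Variables (R : realType) (X : metricType R) (H : X -> R -> R).

Definition lagrangian (x : X) (v : R) : \bar R :=
  ereal_sup [set (p * v - H x p)%:E | p in `[0, +oo[].

Definition lagrangian_dom : set (X * R) :=
  [set z | 0 <= z.2 /\ (lagrangian z.1 z.2 < +oo)%E].

Definition admissible (xi : R -> X) : Prop :=
  abs_continuous `[0, +oo[ xi /\
  exists2 rs : seq R, path <%R 0 rs &
  forall I, I \in pieces 0 rs +oo%O ->
  exists v : R, [/\ 0 <= v, ae_speed xi [set` I] v,
    (forall r, r \in I -> lagrangian (xi r) v \is a fin_num) &
    {within [set` I], continuous (fun r => lagrangian (xi r) v)}].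

Definition admissible_from (x : X) : set (R -> X) :=
  [set xi | admissible xi /\ xi 0 = x].

Definition subsolution (T : R) (u : X -> R -> R) : Prop :=
  arcwise_continuous `]0, T[ u /\
  forall (x : X) (t : R), 0 < t < T ->
  forall xi, admissible_from x xi ->
  let w := fun h => u (xi h) (t - h) in
  forall h, 0 <= h < t ->
  forall p, right_superdifferential `[0, t[ w h p ->
  ((- p)%:E <= lagrangian (xi h) (right_speed xi h))%E.

Definition supersolution (T : R) (u : X -> R -> R) : Prop :=
  arcwise_continuous `]0, T[ u /\
  forall (x : X) (t : R), 0 < t < T ->
  forall e : R, 0 < e ->
  exists (xi : R -> X) (w : R -> R),
  [/\ admissible_from x xi,
      {within `[0, t[, continuous w},
      w 0 = u x t,
      (forall h, 0 <= h < t -> w h >= u (xi h) (t - h) - e) &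
      forall h, 0 <= h < t ->
      forall p, right_subdifferential `[0, t[ w h p ->
      ((- p)%:E >= lagrangian (xi h) (right_speed xi h))%E].

Definition solution (T : R) (u0 : X -> R) (u : X -> R -> R) : Prop :=
  [/\ arcwise_continuous `[0, T[ u, subsolution T u, supersolution T u &
      forall x, u x 0 = u0 x].

Definition value_function (u0 : X -> R) (x : X) (t : R) : \bar R :=
  ereal_inf [set (\int[lebesgue_measure]_(r in `[0%R, t])
                    lagrangian (xi r) (metric_derivative xi r)
                  + (u0 (xi t))%:E)%E | xi in admissible_from x].

End HamiltonJacobi.

(* Main.v *)
(* A function [w] on [0, t[ satisfies the one-sided differential inequality of a
   subsolution along an admissible curve iff [w] plus the running cost is
   nondecreasing, and that of a supersolution iff it is nonincreasing: at a
   maximum (minimum) of a perturbed violation, a primitive of the running cost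
   is a test function.  Hence subsolutions are suboptimal and
   supersolutions are almost superoptimal along curves, so every solution equals
   the value function, which in turn satisfies both by dynamic programming.

   For arcwise continuity of the value function, a short piece of an absolutely
   continuous curve is replaced by its arc length parametrization, run at a
   speed [c] for which [L] is bounded; it reaches its end at small cost.  That
   this parametrization has metric speed exactly [c] almost everywhere follows
   from the Vitali covering lemma: on disjoint intervals where the curve is
   too slow, polygonal lengths would fall short of the length of the curve.
   Continuity in time uses [L x v >= K v - C_K] for every [K], which absorbs the
   modulus of continuity of [u0]. *)

Require Import Defs.
From HB Require Import structures.
From mathcomp Require Import all_boot all_order all_algebra.
From mathcomp Require Import all_classical all_reals all_analysis.
From mathcomp Require Import measurable_realfun lra.

Set Implicit Arguments.
Unset Strict Implicit.
Unset Printing Implicit Defensive.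

Import Order.TTheory GRing.Theory Num.Theory.
Import numFieldNormedType.Exports.

Local Open Scope classical_set_scope.
Local Open Scope ring_scope.

(** * Absolutely continuous curves *)

(** The metric derivative is known only almost everywhere, and a merely continuous curve could
    travel on the remaining null set; [ae_speed_dist] uses absolute continuity to exclude this, so
    that speed bounds distance. The speed [c0] comes from the growth of [H]: a bound
    [H x p >= c0 * p] for large [p], uniform in [x], keeps [L] bounded at all speeds up to [c0]. As
    [L] is continuous only where it is finite, this makes constant-speed curves admissible
    everywhere; speed [0] is included, so a curve may also wait. The running cost may jump where a
    curve changes speed. Right differentials see only the piece that starts at the point, where the
    cost has a continuously differentiable primitive, so break points need no separate treatment.
    The differential inequalities stop short of [h = t], where the initial datum is read; a limit
    along the curve closes the gap and uses continuity of solutions up to time [0]. *)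

(** Real induction in place of a compactness argument: the local hypothesis at the supremum [c] of
    the points reachable from [a] both reaches [c] and passes beyond it unless [c = b]. *)
Lemma interval_additive_ind (R : realType) (P : R -> R -> Prop) (a b : R) :
  a <= b ->
  (forall l m r, a <= l -> l <= m -> m <= r -> r <= b ->
    P l m -> P m r -> P l r) ->
  (forall t, a <= t <= b -> exists2 e : R, 0 < e &
    forall l r, a <= l -> l <= t -> t <= r -> r <= b ->
      t - e < l -> r < t + e -> P l r) ->
  P a b.
Proof.
move=> ab Padd Ploc.
pose S := [set s | a <= s <= b /\ P a s].
have Sa : S a.
  split; first by rewrite lexx.
  have [|e e0 Pe] := Ploc a; first by rewrite lexx.
  by apply: Pe; rewrite ?ltrBlDr ?ltrDl ?lexx.
have ubS : ubound S b by move=> s [/andP[]].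
have hS : has_sup S by split; [exists a|exists b].
set c := sup S.
have ac : a <= c by apply: ub_le_sup => //; exists b.
have cb : c <= b by apply: ge_sup => //; exists a.
have [|e e0 Pe] := Ploc c; first by rewrite ac.
have [s Ss cs] := sup_adherent e0 hS.
have sc : s <= c by apply: ub_le_sup => //; exists b.
have [/andP[as_ sb] Pas] := Ss.
have PaC : P a c.
  by apply: (Padd a s c) => //; apply: Pe; rewrite ?ltrDl.
have [cb'|bc] := ltP c b; last first.
  by have -> : b = c by apply/eqP; rewrite eq_le bc cb.
pose s' := Num.min b (c + e / 2).
have s'b : s' <= b by rewrite /s' ge_min lexx.
have cs' : c < s' by rewrite /s' lt_min cb' ltrDl divr_gt0.
have s'e : s' < c + e.
  by rewrite /s' gt_min; apply/orP; right; rewrite ltrD2l; lra.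
have : S s'.
  split; first by rewrite s'b andbT (le_trans ac)// ltW.
  apply: (Padd a c s') => //; first exact: ltW.
  by apply: Pe => //; [exact: ltW|rewrite ltrBlDr ltrDl].
move=> Ss'; have : s' <= c by apply: ub_le_sup => //; exists b.
by rewrite leNgt cs'.
Qed.

Section lists_of_intervals.
Variables (R : realType).
Implicit Types (s : seq (R * R)).

Definition before (i j : R * R) := i.2 <= j.1.

Lemma sum_monotone_le (F : R -> R) (a b : R) s :
  a <= b -> {in `[a, b] &, {homo F : x y / x <= y}} ->
  (forall i, i \in s -> [&& a <= i.1, i.1 <= i.2 & i.2 <= b]) ->
  pairwise before s ->
  \sum_(i <- s) (F i.2 - F i.1) <= F b - F a.
Proof.
elim: s a => [|i s IH] a ab Fh sab /=.
  by rewrite big_nil subr_ge0 => _; apply: Fh; rewrite // in_itv/= lexx ?ab.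
case/andP => /allP bi ps; rewrite big_cons.
have /and3P[ai ii ib] := sab i (mem_head _ _).
have : \sum_(j <- s) (F j.2 - F j.1) <= F b - F i.2.
  apply: IH => //.
    move=> x y; rewrite !in_itv/= => /andP[? ?] /andP[? ?]; apply: Fh;
      by rewrite in_itv/=; apply/andP; split => //; lra.
  move=> j js; have /and3P[_ -> ->] := sab j (@mem_behead _ (i :: s) j js).
  by rewrite !andbT; exact: (bi j js).
have : F a <= F i.1 by apply: Fh; rewrite ?in_itv/=; lra.
lra.
Qed.

Lemma sum_length_le_measure (G : set R) s : open G ->
  (forall i, i \in s -> i.1 <= i.2 /\ `]i.1, i.2[ `<=` G) ->
  pairwise before s ->
  ((\sum_(i <- s) (i.2 - i.1))%:E <= lebesgue_measure G)%E.
Proof.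
move=> oG sG ps.
(* Cutting [G] at [x] makes the induction work: what remains for the tail lies to the right of
   [i.2], disjoint from the first interval. *)
suff: forall x : R, (forall i, i \in s -> x <= i.1) ->
    ((\sum_(i <- s) (i.2 - i.1))%:E <= lebesgue_measure (G `&` `]x, +oo[))%E.
  have [x xs] : exists x, forall i, i \in s -> x <= i.1.
    case: s sG ps => [|i s] sG /= ps; first by exists 0.
    case/andP: ps => /allP bi _; exists i.1 => j; rewrite inE => /predU1P[->//|].
    by move=> /bi h; apply: le_trans h; exact: (sG i (mem_head _ _)).1.
  move=> /(_ x xs) /le_trans; apply; apply: le_measure; rewrite ?inE//.
  - by apply: measurableI => //; exact: open_measurable.
  - exact: open_measurable.
elim: s sG ps => [|i s IH] sG /=.
  by move=> _ x _; rewrite big_nil.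
case/andP => /allP bi ps x xs; rewrite big_cons EFinD.
have [ii iG] := sG i (mem_head _ _).
have {}IH : ((\sum_(j <- s) (j.2 - j.1))%:E <=
   lebesgue_measure (G `&` `]i.2, +oo[))%E.
  apply: IH => // j js.
  by apply: sG; exact: (@mem_behead _ (i :: s)).
have -> : (i.2 - i.1)%:E = lebesgue_measure `]i.1, i.2[%classic.
  rewrite lebesgue_measure_itv/= lte_fin; case: ltP => // ?.
  by have -> : i.2 = i.1 by [apply/eqP; rewrite eq_le ii andbT];rewrite subrr.
have mG : measurable G by exact: open_measurable.
apply: (@le_trans _ _ (lebesgue_measure `]i.1, i.2[%classic +
  lebesgue_measure (G `&` `]i.2, +oo[))%E); first exact: leeD2l.
rewrite -measureU//=; last 2 first.
- exact: measurableI.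
- rewrite -subset0 => y [/= + [_ ]]; rewrite !in_itv/= => /andP[_ ] h /andP[].
  by move=> /(lt_trans h); rewrite ltxx.
apply: le_measure; rewrite ?inE//.
- by apply: measurableU => //; exact: measurableI.
- exact: measurableI.
move=> y [/[dup] /iG Gy|[Gy]] /=; rewrite !in_itv/= => /andP[h _]; split => //=;
  rewrite ?in_itv/= ?andbT.
- by apply: le_lt_trans h; exact/xs/mem_head.
- by apply: le_lt_trans h; apply: le_trans ii; exact/xs/mem_head.
Qed.

End lists_of_intervals.

Section absolute_continuity.
Variables (R : realType) (X : metricType R).
Implicit Types (xi : R -> X).

(** Ordered lists replace the indexed disjoint families of the definition because they can be
    concatenated, as [ae_speed_dist] requires. *)
Lemma abs_continuous_seq xi (I : set R) (a b e : R) : a <= b ->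
  abs_continuous I xi -> `[a, b] `<=` I -> 0 < e ->
  exists2 d : R, 0 < d & forall s : seq (R * R),
    (forall i, i \in s -> [&& a <= i.1, i.1 <= i.2 & i.2 <= b]) ->
    pairwise (@before R) s -> \sum_(i <- s) (i.2 - i.1) < d ->
    \sum_(i <- s) mdist (xi i.1) (xi i.2) < e.
Proof.
move=> ab ac abI e0; have [d d0 H] := ac a b ab abI e e0.
exists d => // s sab ps sd.
have /= := H (size s) (fun i => (tnth (in_tuple s) i).1)
  (fun i => (tnth (in_tuple s) i).2).
rewrite -!(big_tnth _ _ s xpredT (fun i => i.2 - i.1)).
rewrite -!(big_tnth _ _ s xpredT (fun i => mdist (xi i.1) (xi i.2))).
apply => //.
- by move=> i; have /and3P[] := sab _ (mem_tnth i (in_tuple s)).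
- move=> i j _ _ [x [/=]]; rewrite !in_itv/= => /andP[i1 i2] /andP[j1 j2].
  move: ps => /(pairwiseP (0, 0)) ps.
  apply/val_inj => /=; apply/eqP; rewrite eqn_leq; apply/andP; split;
    rewrite leqNgt; apply/negP => ij.
  + have := ps j i (ltn_ord j) (ltn_ord i) ij.
    rewrite /before -!(tnth_nth _ (in_tuple s)) => h.
    by have := lt_trans (lt_le_trans j2 h) i1; rewrite ltxx.
  + have := ps i j (ltn_ord i) (ltn_ord j) ij.
    rewrite /before -!(tnth_nth _ (in_tuple s)) => h.
    by have := lt_trans (lt_le_trans i2 h) j1; rewrite ltxx.
Qed.

Lemma abs_continuousS xi (I J : set R) :
  J `<=` I -> abs_continuous I xi -> abs_continuous J xi.
Proof. by move=> JI ac a b ab abJ; apply: ac => //; exact: subset_trans JI. Qed.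

Lemma negligible_open_cover (N : set R) (e : R) : 0 < e ->
  (@lebesgue_measure R).-negligible N ->
  exists G : set R, [/\ open G, N `<=` G & (lebesgue_measure G < e%:E)%E].
Proof.
move=> e0 [A [mA A0 NA]].
have [|G [oG AG Ge]] := @lebesgue_regularity_outer R A e mA _ e0.
  by rewrite [ltLHS]A0.
exists G; split => //; first exact: subset_trans AG.
rewrite (_ : G = A `|` (G `\` A)); last first.
  by rewrite setDUK.
rewrite measureU//=.
- by rewrite [X in (X + _)%E]A0 add0e.
- by apply: measurableD => //; exact: open_measurable.
- by rewrite setDIK.
Qed.

(** Outside an open set [G] of small measure, difference quotients near each point stay below
    [v + e]; inside [G], absolute continuity bounds the sum of the increments by [e].
    [interval_additive_ind] joins the two kinds of local estimates. *)
Lemma ae_speed_dist xi (I : set R) (a b v : R) : a <= b -> 0 <= v ->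
  abs_continuous I xi -> `[a, b] `<=` I -> ae_speed xi `]a, b[ v ->
  mdist (xi a) (xi b) <= v * (b - a).
Proof.
move=> ab v0 ac abI av.
suff H : forall e, 0 < e -> mdist (xi a) (xi b) <= (v + e) * (b - a) + e.
  apply/ler_addgt0Pr => e e0.
  have p : 0 < b - a + 1 by lra.
  have := H (e / (b - a + 1)) (divr_gt0 e0 p).
  set f := e / _; have -> : e = f * (b - a + 1) by rewrite /f divfK// gt_eqF.
  by rewrite !mulrDl !mulrDr; lra.
move=> e e0.
have [d d0 Hd] := abs_continuous_seq ab ac abI e0.
have [|G [oG NG Gd]] := @negligible_open_cover
  (~` [set t | `]a, b[%classic t -> has_metric_derivative xi t v] `|` [set a; b]) d d0.
  apply: negligibleU => //; apply: negligibleU; apply/negligibleP => //;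
    exact: lebesgue_measure_set1.
(* The list collects the increments over intervals inside [G]; in this form the estimate is additive
   in [[l, r]]. *)
pose P l r := exists s : seq (R * R), [/\
  forall i, i \in s -> [&& l <= i.1, i.1 <= i.2 & i.2 <= r],
  forall i, i \in s -> `]i.1, i.2[ `<=` G,
  pairwise (@before R) s &
  mdist (xi l) (xi r) <=
    (v + e) * (r - l) + \sum_(i <- s) mdist (xi i.1) (xi i.2)].
have [s [s1 s2 s3 s4]] : P a b.
  apply: interval_additive_ind => //.
    move=> l m r al lm mr rb [s [s1 s2 s3 s4]] [s' [s'1 s'2 s'3 s'4]].
    exists (s ++ s'); split.
    - move=> i; rewrite mem_cat => /orP[/s1|/s'1] /and3P[? ? ?]; lra.
    - by move=> i; rewrite mem_cat => /orP[/s2|/s'2].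
    - rewrite pairwise_cat s3 s'3 !andbT; apply/allrelP => i j /s1 + /s'1.
      by move=> /and3P[_ _ im] /and3P[mj _ _]; exact: le_trans mj.
    - rewrite big_cat/=; have := metric_triangle (xi l) (xi m) (xi r).
      move: s4 s'4; nra.
  move=> t /andP[at_ tb].
  have [Gt|nGt] := pselect (G t).
    have /nbhs_ballP[f /= f0 fG] := open_nbhs_nbhs (conj oG Gt).
    exists f => // l r al lt tr rb fl fr.
    exists [:: (l, r)]; split => //.
    - by move=> i; rewrite inE => /eqP -> /=; rewrite !lexx (le_trans lt).
    - move=> i; rewrite inE => /eqP -> /= x /=; rewrite in_itv/= => /andP[lx xr].
      by apply: fG; rewrite /ball/= ltr_distlC; apply/andP; split; lra.
    - rewrite big_seq1/= lerDr mulr_ge0//; last by rewrite subr_ge0 (le_trans lt).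
      by rewrite addr_ge0// ltW.
  have Ht : has_metric_derivative xi t v.
    have : ~ ((~` [set t | `]a, b[%classic t -> has_metric_derivative xi t v] `|`
      [set a; b]) t) by move=> /NG.
    move/not_orP => [/contrapT Ht /not_orP[/eqP ta /eqP tb']]; apply: Ht => /=.
    by rewrite in_itv/= !lt_neqAle at_ tb eq_sym ta tb'.
  have /nbhs_ballP[f /= f0 fP] : \forall s \near t^', mdiff_quotient xi t s < v + e.
    by apply: (cvgr_lt v) => //; rewrite ltrDl.
  have dt x : `|x - t| < f -> mdist (xi x) (xi t) <= (v + e) * `|x - t|.
    move=> xt; have [->|xnt] := eqVneq x t.
      by rewrite mdistxx mulr_ge0// addr_ge0// ltW.
    rewrite -ler_pdivrMr ?normr_gt0 ?subr_eq0// ltW//; apply: fP => //.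
    by rewrite /ball/= distrC.
  exists f => // l r al lt tr rb fl fr; exists [::]; split => //.
  rewrite big_nil addr0.
  have := dt l; rewrite ler0_norm ?subr_le0// => /(_ ltac:(lra)) dl.
  have := dt r; rewrite ger0_norm ?subr_ge0// => /(_ ltac:(lra)) dr.
  have := metric_triangle (xi l) (xi t) (xi r); rewrite (metric_sym (xi t)).
  by move: dl dr; nra.
apply: (le_trans s4); rewrite lerD2l ltW//; apply: Hd => //.
rewrite -lte_fin (le_lt_trans _ Gd)//; apply: sum_length_le_measure => // i is_.
by split; [have /and3P[] := s1 _ is_|exact: s2].
Qed.

End absolute_continuity.

(** * Null sets and integrals *)

Section translation.
Variable R : realType.
Local Notation mu := (@lebesgue_measure R).

Lemma measurable_shift (h : R) :
  measurable_fun setT (fun x : measurableTypeR R => x + h : measurableTypeR R).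
Proof.
apply: continuous_measurable_fun => x.
by apply: cvgD; [exact: cvg_id|exact: cvg_cst].
Qed.

Lemma lebesgue_measure_shift (h : R) (A : set (measurableTypeR R)) :
  measurable A -> mu ((fun x => x + h) @^-1` A) = mu A.
Proof.
pose nu : {measure set (measurableTypeR R) -> \bar R} :=
  pushforward mu (fun x : measurableTypeR R => x + h : measurableTypeR R).
move=> mA; symmetry.
apply: (lebesgue_measure_unique (mu := nu (measurable_shift h))) => // _ [[a b] _ <-].
rewrite /nu /= /pushforward /=.
rewrite (_ : _ @^-1` _ = `]a - h, b - h]%classic); last first.
  by apply/seteqP; split => x /=; rewrite !in_itv/= ltrBlDr lerBrDr.
rewrite !lebesgue_measure_itv/= !lte_fin ltrD2r; case: ifP => // _.
by rewrite -!EFinB; congr EFin; lra.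
Qed.

Lemma negligible_shift (h : R) (N : set R) :
  mu.-negligible N -> mu.-negligible [set x | N (x + h)].
Proof.
move=> [A [mA A0 NA]]; exists ((fun x => x + h) @^-1` A); split.
- by rewrite -[X in measurable X]setTI; exact: measurable_shift.
- by rewrite lebesgue_measure_shift.
- by move=> x /NA.
Qed.

Lemma Rintegral_shift (h a b : R) (f : R -> R) :
  mu.-integrable `[a + h, b + h] (EFin \o f) ->
  \int[mu]_(x in `[a, b]) f (x + h) = \int[mu]_(x in `[a + h, b + h]) f x.
Proof.
move=> intf.
pose nu : {measure set (measurableTypeR R) -> \bar R} :=
  pushforward mu (fun x : measurableTypeR R => x + h : measurableTypeR R).
have nuE (D : set (measurableTypeR R)) (g : measurableTypeR R -> \bar R) :
    (\int[nu (measurable_shift h)]_(x in D) g x = \int[mu]_(x in D) g x)%E.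
  by apply: eq_measure_integral => A mA _; exact: lebesgue_measure_shift.
have preE (u v : R) : (fun x : R => x + h) @^-1` `[u + h, v + h] = `[u, v]%classic.
  by apply/seteqP; split => x /=; rewrite !in_itv/= !lerD2r.
have mab : measurable (`[a + h, b + h]%classic : set (measurableTypeR R)) by [].
have mf := (integrableP _ _ _ intf).1.
rewrite /Rintegral.
(* The pushforward formula is applied to nonnegative functions, hence to the positive and the
   negative part separately. *)
suff E (g : measurableTypeR R -> \bar R) :
    (forall x, 0 <= g x)%E -> measurable_fun `[a + h, b + h] g ->
    (\int[mu]_(x in `[a, b]) g (x + h)%R =
     \int[mu]_(x in `[(a + h)%R, (b + h)%R]) g x)%E.
  congr fine; rewrite integralE [RHS]integralE; congr (_ - _)%E.
  - have <- := E ((EFin \o f)^\+)%E (fun _ => funepos_ge0 _ _) (measurable_funepos mf).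
    by apply: eq_integral => x _; rewrite !funeposE.
  - have <- := E ((EFin \o f)^\-)%E (fun _ => funeneg_ge0 _ _) (measurable_funeneg mf).
    by apply: eq_integral => x _; rewrite !funenegE.
move=> g0 mg; rewrite -[RHS]nuE.
rewrite (ge0_integral_pushforward (measurable_shift h))//.
by rewrite -(preE a b).
Qed.

End translation.

Section ae_integral.
Context d (T : measurableType d) (R : realType).
Variable mu : {measure set T -> \bar R}.
Local Open Scope ereal_scope.

Import HBNNSimple.

(* The measurability of the integrand of [value_function] need not be settled:
   a simple function below [f] stays below [g] once cut off on a null set. *)
Lemma ge0_ae_le_integral_nonmeasurable (D : set T) (f g : T -> \bar R) :
  (forall x, D x -> 0 <= f x) -> (forall x, D x -> 0 <= g x) ->
  {ae mu, forall x, D x -> f x <= g x} ->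
  \int[mu]_(x in D) f x <= \int[mu]_(x in D) g x.
Proof.
move=> f0 g0 [N [mN N0 fgN]].
rewrite !ge0_integralE//; apply: ge_ereal_sup => _ [h /= hf <-].
have mNc : measurable (~` N) by exact: measurableC.
have <- : sintegral mu (proj_nnsfun h mNc) = sintegral mu h.
  have sE (k : {nnsfun T >-> R}) : \int[mu]_x (k x)%:E = sintegral mu k.
    by rewrite integral_nnsfun// patch_setT.
  rewrite -!sE (ge0_negligible_integral mN)//; last 2 first.
    by apply/measurable_EFinP.
    by move=> x _; rewrite lee_fin.
  rewrite [RHS](ge0_negligible_integral mN)//; last 2 first.
    by apply/measurable_EFinP.
    by move=> x _; rewrite lee_fin.
  apply: eq_integral => x; rewrite inE => -[_ nNx].
  by rewrite /= mindicE mem_set// mulr1.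
apply: ereal_sup_ubound; exists (proj_nnsfun h mNc) => //= x.
rewrite mindicE; have [/set_mem nNx|_] := boolP (x \in ~` N); last first.
  by rewrite mulr0 patchE; case: ifPn => // /set_mem; exact: g0.
rewrite mulr1; apply: (le_trans (hf x)).
rewrite !patchE; case: ifPn => // /set_mem Dx.
by apply: contrapT => fg; apply: nNx; apply: fgN => /= /(_ Dx).
Qed.

(** Positive and negative parts are compared in both directions; this lets the metric derivative be
    exchanged for the right speed under the integral. *)
Lemma ae_eq_integral_nonmeasurable (D : set T) (f g : T -> \bar R) :
  {ae mu, forall x, D x -> f x = g x} ->
  \int[mu]_(x in D) f x = \int[mu]_(x in D) g x.
Proof.
move=> fg; rewrite integralE [RHS]integralE.
have E (k : (T -> \bar R) -> (T -> \bar R)) : (forall u x, 0 <= k u x) ->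
    (forall u v x, u x = v x -> k u x = k v x) ->
    \int[mu]_(x in D) k f x = \int[mu]_(x in D) k g x.
  move=> k0 kE; apply/eqP; rewrite eq_le; apply/andP; split;
    apply: ge0_ae_le_integral_nonmeasurable => //; apply: filterS fg => x fgx Dx;
    by rewrite (kE f g)// fgx.
by congr (_ - _); apply: (E (fun u => _ u)) => // u v x uv;
  rewrite ?funeposE ?funenegE uv.
Qed.

End ae_integral.

(** * Curves of full length *)

Section polygonal_length.
Variables (R : realType) (X : metricType R).
Implicit Types (xi : R -> X) (p : seq R).

Fixpoint polygonal_length xi (a : R) p : R :=
  if p is b :: p' then mdist (xi a) (xi b) + polygonal_length xi b p' else 0.

Variables (g : R -> X) (c : R).
Hypothesis g_lip : forall s t, mdist (g s) (g t) <= c * `|s - t|.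

Let D (l r : R) := c * (r - l) - mdist (g l) (g r).

Let D_ge0 l r : l <= r -> 0 <= D l r.
Proof. by move=> lr; rewrite subr_ge0 (le_trans (g_lip _ _))// distrC ger0_norm ?subr_ge0. Qed.

Let DD l m r : D l m + D m r <= D l r.
Proof. by rewrite /D; have := metric_triangle (g l) (g m) (g r); lra. Qed.

Let Dxx l : D l l = 0.
Proof. by rewrite /D subrr mulr0 mdistxx subr0. Qed.

(* How much shorter than the maximal length [c * (t - a)] the polygonal line
   with vertices [a :: p], stopped at time [t], is. *)
Fixpoint length_defect (a : R) p (t : R) : R :=
  if p is b :: p' then
    if t < b then D a t else D a b + length_defect b p' t
  else D a t.

Lemma length_defect_ge0 a p t : path <=%R a p -> a <= t -> 0 <= length_defect a p t.
Proof.
elim: p a => [|b p IH] a /=; first by move=> _; exact: D_ge0.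
move=> /andP[ab pb] at_; case: ltP => bt; first exact: D_ge0.
by rewrite addr_ge0// ?D_ge0// IH.
Qed.

Lemma length_defect_homo a p s t : path <=%R a p -> a <= s -> s <= t ->
  length_defect a p s <= length_defect a p t.
Proof.
elim: p a => [|b p IH] a /=.
  by move=> _ _ st; have := DD a s t; have := D_ge0 st; lra.
move=> /andP[ab pb] as_ st; case: ltP => sb; case: ltP => tb.
- by have := DD a s t; have := D_ge0 st; lra.
- have := length_defect_ge0 pb tb; have := DD a s b; have := D_ge0 (ltW sb); lra.
- by have := lt_le_trans tb sb; rewrite ltNge st.
- by rewrite lerD2l IH.
Qed.

(** If a vertex [x] lay strictly between [s] and [t], the increment would only dominate
    [D s x + D x t], which superadditivity leaves below [D s t]; hence the last hypothesis. *)
Lemma length_defect_increment a p s t : path <=%R a p -> a <= s -> s <= t ->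
  (forall x, x \in p -> x <= s \/ t <= x) ->
  D s t <= length_defect a p t - length_defect a p s.
Proof.
elim: p a => [|b p IH] a /=.
  by move=> _ _ st _; have := DD a s t; lra.
move=> /andP[ab pb] as_ st xst; case: (ltP s b) => sb; case: (ltP t b) => tb.
- by have := DD a s t; lra.
(* Here [b] is a vertex with [s < b <= t], so it can only be the end [t]. *)
- have -> : t = b.
    have [bs|tb'] := xst b (mem_head _ _).
      by have := lt_le_trans sb bs; rewrite ltxx.
    by apply/eqP; rewrite eq_le tb' tb.
  have := length_defect_ge0 pb (lexx b); have := DD a s b; lra.
- by have := lt_le_trans tb sb; rewrite ltNge st.
- rewrite opprD addrACA subrr add0r IH// => x xp; apply: xst.
  by rewrite inE xp orbT.
Qed.

Lemma length_defect_last a p : path <=%R a p ->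
  length_defect a p (last a p) = c * (last a p - a) - polygonal_length g a p.
Proof.
elim: p a => [|b p IH] a /=; first by rewrite Dxx subrr mulr0 subr0.
move=> /andP[ab pb].
have blast : b <= last b p.
  by move: pb; rewrite (path_sortedE le_trans) => /andP[/allP bp _];
    have := mem_last b p; rewrite inE => /predU1P[->//|/bp].
by rewrite ltNge blast/= IH// /D; lra.
Qed.

(** [length_defect] is nondecreasing in time, so its increments over ordered intervals add up to at
    most the defect at the end; with no vertex inside an interval, each increment dominates the
    chord defect [D]. *)
Lemma disjoint_defect_le a p (b k : R) (s : seq (R * R)) :
  path <=%R a p -> last a p = b -> a <= b ->
  (forall i, i \in s -> [&& a <= i.1, i.1 <= i.2 & i.2 <= b]) ->
  (forall i, i \in s -> k * (i.2 - i.1) <= D i.1 i.2) ->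
  (forall i x, i \in s -> x \in p -> x <= i.1 \/ i.2 <= x) ->
  pairwise (@before R) s ->
  k * (\sum_(i <- s) (i.2 - i.1)) <= c * (b - a) - polygonal_length g a p.
Proof.
move=> ap lp ab sab sk sp ps; rewrite -lp -length_defect_last// lp.
have : \sum_(i <- s) (length_defect a p i.2 - length_defect a p i.1) <=
    length_defect a p b - length_defect a p a.
  apply: sum_monotone_le => // x y; rewrite !in_itv/= => /andP[ax _] /andP[ay _].
  exact: length_defect_homo.
have := length_defect_ge0 ap (lexx a).
suff : k * (\sum_(i <- s) (i.2 - i.1)) <=
  \sum_(i <- s) (length_defect a p i.2 - length_defect a p i.1) by lra.
rewrite mulr_sumr big_seq [leRHS]big_seq; apply: ler_sum => i is_.
have /and3P[ai ii ib] := sab i is_.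
apply: (le_trans (sk i is_)); apply: length_defect_increment => // x.
exact: sp.
Qed.

End polygonal_length.

(** * Vitali coverings and the speed of curves of full length *)

Section vitali.
Variable R : realType.
Local Notation mu := (@lebesgue_measure R).

Lemma negligible_small_cover (E : set R) :
  (forall e : R, 0 < e ->
    exists A : set (measurableTypeR R), [/\ measurable A, E `<=` A & (mu A <= e%:E)%E]) ->
  mu.-negligible E.
Proof.
move=> H; have n0 n : 0 < (n.+1%:R^-1 : R) by rewrite invr_gt0.
pose A n := projT1 (cid (H _ (n0 n))).
have AP n : [/\ measurable (A n), E `<=` A n & (mu (A n) <= (n.+1%:R^-1)%:E)%E].
  by rewrite /A; case: cid.
have mA : measurable (\bigcap_n A n : set (measurableTypeR R)).
  by apply: bigcapT_measurable => n; have [] := AP n.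
exists (\bigcap_n A n); split => //.
- apply/eqP; rewrite -measure_le0; apply/lee_addgt0Pr => e e0; rewrite add0e.
  near \oo => n.
  apply: (@le_trans _ _ (mu (A n))).
    apply: le_measure; rewrite ?inE//; first by have [] := AP n.
    exact: bigcap_inf.
  have [_ _ /le_trans] := AP n; apply; rewrite lee_fin ltW//.
  by near: n; have := near_infty_natSinv_lt (PosNum e0).
- by move=> x Ex n _; have [_ + _] := AP n; apply.
Unshelve. all: by end_near. Qed.

(* [M] bounds the total length of every finite family of disjoint intervals
   [J t]; by the Vitali covering lemma the set of all [t] is then covered by
   five-fold dilations of total length at most [5 * M]. *)
Lemma vitali_bound (E : set R) (J : R -> R * R) (a b M : R) :
  (forall t, E t -> [/\ a <= (J t).1, (J t).1 <= t, t <= (J t).2,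
     (J t).2 <= b & (J t).1 < (J t).2]) ->
  0 <= M ->
  (forall s : seq (R * R), (forall i, i \in s -> exists2 t, E t & i = J t) ->
     pairwise (@before R) s -> \sum_(i <- s) (i.2 - i.1) <= M) ->
  exists A : set (measurableTypeR R), [/\ measurable A, E `<=` A & (mu A <= (5 * M)%:E)%E].
Proof.
move=> EJ M0 JM.
pose cen t := ((J t).1 + (J t).2) / 2.
pose rad t := ((J t).2 - (J t).1) / 2.
(* The covering lemma asks for a ball of positive radius at every index; outside [E] any ball will
   do. *)
pose B t := if t \in E then ball (cen t) (rad t) else ball (0 : R) 1.
have rad_gt0 t : E t -> 0 < rad t by move=> /EJ[*]; rewrite /rad; lra.
have BE t : E t -> B t = ball (cen t) (rad t) by move=> Et; rewrite /B mem_set.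
have isB t : is_ball (B t) by rewrite /B; case: ifP => _; exact: is_ball_ball.
have B0 t : 0 < (radius (B t))%:num.
  rewrite /B; case: ifPn => [/set_mem/rad_gt0 r0|_]; rewrite radius_ball_num//.
  exact: ltW.
have EBr t : E t -> (radius (B t))%:num <= (b - a) / 2.
  move=> Et; rewrite BE// radius_ball_num; last exact/ltW/rad_gt0.
  by have [*] := EJ t Et; rewrite /rad; lra.
have clB t : E t -> closure (B t) = `[(J t).1, (J t).2]%classic.
  move=> Et; rewrite is_ball_closure// BE// cpoint_ball ?rad_gt0//.
  rewrite radius_ball_num; last exact/ltW/rad_gt0.
  rewrite closed_ball_itv ?rad_gt0//.
  rewrite (_ : cen t - rad t = (J t).1); last by rewrite /cen /rad; lra.
  by rewrite (_ : cen t + rad t = (J t).2)//; rewrite /cen /rad; lra.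
have [D [cD DE tD cov]] := vitali_lemma_infinite_cover isB B0 EBr.
pose C t : set (measurableTypeR R) := closure (5 *` B t).
have mC t : measurable (C t) by apply: closed_measurable; exact: closed_closure.
have muC t : E t -> mu (C t) = (5 * ((J t).2 - (J t).1))%:E.
  move=> Et; rewrite /C is_ball_closure; last exact: is_scale_ball.
  rewrite lebesgue_measure_closed_ball// radius_scale_ball// BE//.
  rewrite radius_ball_num; last exact/ltW/rad_gt0.
  by congr EFin; rewrite /rad; lra.
have ECov : E `<=` \bigcup_(t in D) C t.
  move=> t Et; apply: cov; exists t => //=; rewrite clB//= in_itv/=.
  by have [_ -> ->] := EJ t Et.
have sumM (s : seq R) : uniq s -> (forall t, t \in s -> D t) ->
    \sum_(t <- s) ((J t).2 - (J t).1) <= M.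
  (* Sorting by left end points turns disjointness of the closed intervals into the order
     [before]. *)
  move=> us sD; pose key := relpre (fun t => (J t).1) (<=%R : rel R).
  have perms : perm_eq (sort key s) s by rewrite perm_sort.
  rewrite -(perm_big _ perms) -(big_map J xpredT (fun i => i.2 - i.1)).
  apply: JM.
    move=> i /mapP[t]; rewrite mem_sort => /sD/DE Et ->; by exists t.
  rewrite pairwise_map.
  have : pairwise [rel t u | key t u && (t != u)] (sort key s).
    rewrite pairwise_relI -uniq_pairwise sort_uniq us andbT -sorted_pairwise.
      by apply: sort_sorted => t u; exact: le_total.
    by move=> u t v; exact: le_trans.
  apply: (sub_in_pairwise (P := [in s])) => [t u ts us' /= /andP[tu tnu]|]; last first.
    by apply/allP => t; rewrite mem_sort.
  rewrite /before leNgt; apply/negP => ut.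
  move/trivIsetP : tD => /(_ t u (sD _ ts) (sD _ us') tnu) /=.
  rewrite !clB; [|exact/DE/sD|exact/DE/sD].
  apply/eqP/set0P; exists (J u).1; split => /=; rewrite in_itv/=.
    by rewrite tu ltW.
  by have [_ _ _ _ /ltW ->] := EJ u (DE _ (sD _ us')); rewrite lexx.
have /pfcard_geP[D0|[f]] := cD.
  exists set0; split => //; last by rewrite measure0 lee_fin mulr_ge0.
  by move=> t /ECov; rewrite D0 bigcup_set0.
(* The countable family is exhausted by finite ones; [undup] removes repetitions of the enumeration
   [f], since [sumM] wants distinct indices. *)
pose s n := undup [seq f i | i <- iota 0 n].
have sP n t : reflect (exists2 i, (i < n)%N & t = f i) (t \in s n).
  rewrite mem_undup; apply: (iffP mapP) => -[i].
    by rewrite mem_iota/= add0n => ? ?; exists i.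
  by move=> ? ?; exists i => //; rewrite mem_iota/= add0n.
pose F n : set (measurableTypeR R) := \bigcup_(t in [set` s n]) C t.
have mF n : measurable (F n).
  by rewrite /F bigcup_seq; apply: bigsetU_measurable => t _; exact: mC.
have DF : \bigcup_(t in D) C t = \bigcup_n F n.
  apply/seteqP; split => [x [t Dt Cx]|x [n _ [t /= + Cx]]].
    have [n _ fn] := @surj _ _ _ _ f t Dt; exists n.+1 => //; exists t => //=.
    by apply/sP; exists n.
  by move=> /sP[i _ ti]; exists t => //; rewrite ti; exact: funS.
have ndF : {homo F : n m / (n <= m)%N >-> (n <= m)%O}.
  move=> n m nm; apply/subsetPset => x [t /= + Cx] => /sP[i im ti].
  by exists t => //=; apply/sP; exists i => //; rewrite (leq_trans im).
have mUF : measurable (\bigcup_n F n) by exact: bigcupT_measurable.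
exists (\bigcup_n F n); split => //; first by rewrite -DF.
apply: cvge_le (nondecreasing_cvg_mu mF mUF ndF); apply: nearW => n /=.
rewrite /F; have us : uniq (s n) by exact: undup_uniq.
have sD t : t \in s n -> D t by move=> /sP[i _ ->]; exact: funS.
move: (s n) us sD => s1 us sD.
apply: (@le_trans _ _ (\sum_(t <- s1) mu (C t))%E).
  rewrite bigcup_seq; elim: s1 {us sD} => [|t s1 IH]; first by rewrite !big_nil measure0.
  rewrite !big_cons (le_trans (measureU2 _ _ _))//; last exact: leeD2l.
  by apply: bigsetU_measurable => u _; exact: mC.
rewrite big_seq (eq_bigr (fun t => (5 * ((J t).2 - (J t).1))%:E)); last first.
  by move=> t /sD/DE; exact: muC.
rewrite -big_seq sumEFin lee_fin -mulr_sumr ler_wpM2l//; exact: sumM.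
Qed.

Variable X : metricType R.

(** Difference quotients never exceed [c], so at an interior time the derivative fails to be [c]
    only if quotients at most [c - 1/(n+1)] accumulate there for some [n]. Each of these countably
    many sets is null. *)
Lemma full_length_ae_speed (g : R -> X) (c tau : R) : 0 <= c -> 0 <= tau ->
  (forall s t, mdist (g s) (g t) <= c * `|s - t|) ->
  (forall e, 0 < e -> exists p, [/\ path <=%R 0 p, last 0 p = tau &
     c * tau - e <= polygonal_length g 0 p]) ->
  ae_speed g `]0, tau[ c.
Proof.
move=> c0 tau0 glip glen.
pose slow k t := 0 < t < tau /\ forall d, 0 < d ->
  exists s, [/\ s != t, `|s - t| < d & mdist (g s) (g t) <= (c - k) * `|s - t|].
have slow0 k : 0 < k -> mu.-negligible (slow k).
  move=> k0; apply: negligible_small_cover => e e0.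
  (* A polygon that misses the full length by at most [eta] leaves disjoint slow intervals a total
     length of at most [eta / k = e / 5]; the five-fold dilation in [vitali_bound] turns this into
     [e]. *)
  pose eta := k * (e / 5).
  have eta0 : 0 < eta by rewrite mulr_gt0// divr_gt0.
  have [p [pp lp pe]] := glen eta eta0.
  have /choice[sel selP] t : exists s, slow k t ->
      [/\ s != t, 0 < s < tau, mdist (g s) (g t) <= (c - k) * `|s - t| &
        forall x, x \in p -> x <= Num.min s t \/ Num.max s t <= x].
    have [[/andP[t0 tt] Ht]|//] := pselect (slow k t); last by exists 0.
    (* The chosen interval must avoid all vertices except [t], which is one of its ends and so may
       be a vertex itself. *)
    pose U := `]0, tau[%classic `&` ~` [set` [seq x <- p | x != t]].
    have oU : open U.
      apply: openI; first exact: interval_open.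
      rewrite openC; apply: (accessible_finite_set_closed.1 _ _ (finite_seq _)).
      exact/hausdorff_accessible/Rhausdorff.
    have Ut : U t.
      by split; [rewrite /= in_itv/= t0|rewrite /= mem_filter eqxx].
    have /nbhs_ballP[d /= d0 dU] := open_nbhs_nbhs (conj oU Ut).
    have [s [snt sd sk]] := Ht d d0.
    have bU x : Num.min s t <= x <= Num.max s t -> U x.
      case: (leP s t) => st /andP[x1 x2];
        apply: dU; rewrite /ball/= distrC; apply: le_lt_trans sd.
        by rewrite !ler0_norm; lra.
      by rewrite !ger0_norm; lra.
    exists s => _; split => //.
      have [] := bU s; last by rewrite /= in_itv.
      by rewrite ge_min le_max lexx.
    move=> x xp; apply/orP; rewrite -implyNb -ltNge; apply/implyP => sx.
    rewrite leNgt; apply/negP => xs.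
    have [_ /=] := bU x ltac:(by rewrite !ltW).
    apply; rewrite mem_filter xp andbT; apply/eqP => xt.
    by move: sx xs; rewrite xt; case: (ltgtP s t) snt => // st _;
      rewrite ?ltxx.
  pose J t := (Num.min (sel t) t, Num.max (sel t) t).
  have := @vitali_bound (slow k) J 0 tau (e / 5).
  rewrite (_ : 5 * (e / 5) = e); last by lra.
  apply.
  - move=> t tE; have [snt /andP[s0 st] _ _] := selP t tE.
    have [/andP[t0 tt] _] := tE; rewrite /J/=.
    by case: (ltgtP (sel t) t) snt => //= ? _; split; lra.
  - by rewrite ltW// divr_gt0.
  - move=> s sJ ps; rewrite -(ler_pM2l k0) -/eta.
    have := @disjoint_defect_le _ _ g c glip 0 p tau k s pp lp tau0.
    move=> /(_ _ _ _ ps) H; apply: (le_trans (H _ _ _)) => {H}; last by lra.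
    + move=> i /sJ[t tE ->]; have [snt /andP[s0 st] _ _] := selP t tE.
      have [/andP[t0 tt] _] := tE; rewrite /J/=.
      by case: (ltgtP (sel t) t) snt => //= ? _; lra.
    + move=> i /sJ[t tE ->]; have [snt _ H _] := selP t tE; rewrite /J/=.
      move: H; case: (ltgtP (sel t) t) snt => //= st _.
        by rewrite ltr0_norm ?subr_lt0//; lra.
      by rewrite metric_sym gtr0_norm ?subr_gt0//; lra.
    + by move=> i x /sJ[t tE ->] xp; have [_ _ _] := selP t tE; exact.
have n0 n : 0 < (n.+1%:R^-1 : R) by rewrite invr_gt0.
have := negligible_bigcup (fun n => slow0 _ (n0 n)).
apply: negligibleS => t /= /not_implyP[]; rewrite in_itv/= => t0tau ngt.
apply: contrapT => nslow; apply: ngt.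
apply/cvgrPdist_lt => e e0.
have [n ne] : exists n : nat, n.+1%:R^-1 < e.
  have := near_infty_natSinv_lt (PosNum e0).
  by case=> N _ /(_ N (leqnn _)) ?; exists N.
have /not_andP[//|/existsNP[d /not_implyP[d0 /forallNP dP]]] : ~ slow n.+1%:R^-1 t.
  by move=> st; apply: nslow; exists n.
exists d => //= s; rewrite /ball/= => st snt.
have st0 : 0 < `|s - t| by rewrite normr_gt0 subr_eq0.
rewrite /mdiff_quotient; have /not_and3P := dP s.
case=> [//|/negP|/negP]; rewrite ?snt// -?ltNge.
  by rewrite distrC st.
rewrite -ltr_pdivlMr// => h1.
have h2 : mdist (g s) (g t) / `|s - t| <= c by rewrite ler_pdivrMr.
by rewrite ger0_norm ?subr_ge0// ltrBlDr -ltrBlDl (lt_trans _ h1)// ltrD2l ltrN2.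
Qed.

End vitali.

(** * Operations on absolutely continuous curves *)

Section abs_continuous_curves.
Variables (R : realType) (X : metricType R).
Implicit Types (xi zeta : R -> X) (I J : set R).

Lemma abs_continuous_eq I xi zeta : {in I, xi =1 zeta} ->
  abs_continuous I xi -> abs_continuous I zeta.
Proof.
move=> E ac a b ab abI e e0; have [d d0 H] := ac a b ab abI e e0.
exists d => // n l r lr tr sd.
rewrite (eq_bigr (fun i => mdist (xi (l i)) (xi (r i)))); first exact: H.
by move=> i _; have [al [li rb]] := lr i; rewrite !E// inE; apply: abI;
  rewrite /= in_itv/=; lra.
Qed.

Lemma lipschitz_abs_continuous I xi (c : R) : 0 <= c ->
  (forall s t, mdist (xi s) (xi t) <= c * `|s - t|) -> abs_continuous I xi.
Proof.
move=> c0 lip a b ab _ e e0; exists (e / (c + 1)); first by rewrite divr_gt0//; lra.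
move=> n l r lr _ sd.
apply: (@le_lt_trans _ _ ((c + 1) * \sum_(i < n) (r i - l i))); last first.
  by rewrite mulrC -ltr_pdivlMr//; lra.
rewrite mulr_sumr; apply: ler_sum => i _; apply: (le_trans (lip _ _)).
by have [_ [li _]] := lr i; rewrite distrC ger0_norm ?subr_ge0// ler_wpM2r ?subr_ge0//; lra.
Qed.

Lemma abs_continuous_shift I J xi (h : R) :
  (forall r, J (r - h) -> I r) -> abs_continuous I xi ->
  abs_continuous J (fun r => xi (r + h)).
Proof.
move=> JI ac a b ab abJ e e0.
have [||d d0 H] := ac (a + h) (b + h) _ _ e e0; first by rewrite lerD2r.
  by move=> r /=; rewrite in_itv/= => rab; apply: JI; apply: abJ; rewrite /= in_itv/=; lra.
exists d => // n l r lr tr sd.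
apply: (H n (fun i => l i + h) (fun i => r i + h)).
- by move=> i; have := lr i; rewrite !lerD2r.
- move=> i j _ _ [x [/=]]; rewrite !in_itv/= => xi1 xj; apply: tr => //.
  by exists (x - h); split; rewrite /= in_itv/=; lra.
- by under eq_bigr do rewrite opprD addrACA subrr addr0.
Qed.

Lemma abs_continuous_reverse xi :
  abs_continuous setT xi -> abs_continuous setT (fun r => xi (- r)).
Proof.
move=> ac a b ab _ e e0.
have [||d d0 H] := ac (- b) (- a) _ _ e e0 => //; first by rewrite lerN2.
exists d => // n l r lr tr sd.
under eq_bigr do rewrite metric_sym.
apply: (H n (fun i => - r i) (fun i => - l i)).
- by move=> i; have := lr i; rewrite !lerN2 => -[? []].
- move=> i j _ _ [x [/=]]; rewrite !in_itv/= => xi1 xj; apply: tr => //.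
  by exists (- x); split; rewrite /= in_itv/=; lra.
- by under eq_bigr do rewrite opprK addrC.
Qed.

Lemma abs_continuous_cat I xi (h : R) :
  abs_continuous (I `&` `]-oo, h]) xi -> abs_continuous (I `&` `[h, +oo[) xi ->
  abs_continuous I xi.
Proof.
move=> acl acr a b ab abI e e0.
have [bh|hb] := leP b h.
  apply: acl => // x xab; split; first exact: abI.
  by move: xab; rewrite /= !in_itv/=; lra.
have [ha|ah] := leP h a.
  apply: acr => // x xab; split; first exact: abI.
  by move: xab; rewrite /= !in_itv/=; lra.
have [||d d0 H] := acl a h (ltW ah) _ (e / 2) _.
- move=> x xab; split; [apply: abI|]; move: xab; rewrite /= !in_itv/=; lra.
- by rewrite divr_gt0.
have [||d' d'0 H'] := acr h b (ltW hb) _ (e / 2) _.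
- move=> x xab; split; [apply: abI|]; move: xab; rewrite /= !in_itv/=; lra.
- by rewrite divr_gt0.
exists (Num.min d d'); first by rewrite lt_min d0.
move=> n l r lr tr; rewrite lt_min => /andP[sd sd'].
(* Clamping at [h] sends every interval to both sides; on a side that it misses it degenerates to a
   point, so the index set and disjointness are kept. *)
pose mn := fun x : R => Num.min x h; pose mx := fun x : R => Num.max x h.
apply: (@le_lt_trans _ _ (\sum_(i < n) mdist (xi (mn (l i))) (xi (mn (r i))) +
   \sum_(i < n) mdist (xi (mx (l i))) (xi (mx (r i))))).
  rewrite -big_split/=; apply: ler_sum => i _; have [_ [li _]] := lr i.
  rewrite /mn /mx; case: (leP (l i) h) => lh; case: (leP (r i) h) => rh.
  - by rewrite mdistxx addr0.
  - exact: metric_triangle.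
  - by have := le_lt_trans rh lh; rewrite ltNge li.
  - by rewrite mdistxx add0r.
rewrite (splitr e); apply: ltrD.
- apply: (H n (fun i => mn (l i)) (fun i => mn (r i))).
  + move=> i; have [al [li rb]] := lr i; rewrite /mn.
    by case: (leP (l i) h) => lh; case: (leP (r i) h) => rh; lra.
  + move=> i j _ _ [x [/=]]; rewrite !in_itv/= => xi1 xj; apply: tr => //.
    exists x; split; rewrite /= in_itv/=; move: xi1 xj; rewrite /mn;
      rewrite !gt_min !lt_min; lra.
  + apply: le_lt_trans sd; apply: ler_sum => i _; have [_ [li _]] := lr i.
    by rewrite /mn; case: (leP (l i) h) => lh; case: (leP (r i) h) => rh; lra.
- apply: (H' n (fun i => mx (l i)) (fun i => mx (r i))).
  + move=> i; have [al [li rb]] := lr i; rewrite /mx.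
    by case: (leP (l i) h) => lh; case: (leP (r i) h) => rh; lra.
  + move=> i j _ _ [x [/=]]; rewrite !in_itv/= => xi1 xj; apply: tr => //.
    exists x; split; rewrite /= in_itv/=; move: xi1 xj; rewrite /mx;
      rewrite !gt_max !lt_max; lra.
  + apply: le_lt_trans sd'; apply: ler_sum => i _; have [_ [li _]] := lr i.
    by rewrite /mx; case: (leP (l i) h) => lh; case: (leP (r i) h) => rh; lra.
Qed.

(** Arcwise continuity speaks of curves on the whole line, whereas admissible curves start at time
    [0]; freezing them at [xi 0] before that bridges the gap. *)
Lemma abs_continuous_extend xi :
  abs_continuous `[0, +oo[ xi -> abs_continuous setT (fun r => xi (Num.max 0 r)).
Proof.
move=> ac; apply: (@abs_continuous_cat _ _ 0).
- apply: (@abs_continuous_eq _ (fun=> xi 0)).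
    by move=> x; rewrite inE => -[_]; rewrite /= in_itv/= => x0; rewrite max_l.
  apply: (@lipschitz_abs_continuous _ _ 0) => // s t.
  by rewrite mdistxx mul0r.
- apply: (@abs_continuous_eq _ xi).
    by move=> x; rewrite inE => -[_]; rewrite /= in_itv/= andbT => x0; rewrite max_r.
  by apply: abs_continuousS ac => x [].
Qed.

Lemma abs_continuous_continuous xi : abs_continuous setT xi -> continuous xi.
Proof.
move=> ac x; apply/metricType_numDomainType.cvgrPdist_lt => e e0.
have [||d d0 H] := @abs_continuous_seq _ _ xi setT (x - 1) (x + 1) e _ ac _ e0.
- lra.
- by [].
near=> y.
have yd : `|x - y| < Num.min d 1.
  near: y; apply/nbhs_ballP; exists (Num.min d 1) => //=.
  by rewrite lt_min d0 ltr01.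
move: yd; rewrite lt_min ltr_norml ltr_norml => yd.
have [xy|yx] := leP x y.
  have := H [:: (x, y)]; rewrite !big_seq1/=; apply => //; last by lra.
  by move=> i; rewrite inE => /eqP -> /=; lra.
rewrite metric_sym; have := H [:: (y, x)]; rewrite !big_seq1/=; apply => //; last by lra.
by move=> i; rewrite inE => /eqP -> /=; lra.
Unshelve. all: by end_near. Qed.

End abs_continuous_curves.

(** * Almost-everywhere speed and right speed *)

Section speed.
Variables (R : realType) (X : metricType R).
Local Notation mu := (@lebesgue_measure R).
Implicit Types (xi zeta : R -> X) (I J : set R).

Lemma ae_speedS xi I J v : J `<=` I -> ae_speed xi I v -> ae_speed xi J v.
Proof.
move=> JI; apply: negligibleS => t /= /not_implyP[Jt nt].
by move=> /(_ (JI _ Jt)).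
Qed.

Lemma ae_speedU xi I J v :
  ae_speed xi I v -> ae_speed xi J v -> ae_speed xi (I `|` J) v.
Proof.
move=> hI hJ; apply: negligibleS (negligibleU hI hJ) => t /= /not_implyP[[It|Jt] nt].
- by left => /(_ It).
- by right => /(_ Jt).
Qed.

Lemma ae_speed_negligible xi I v : mu.-negligible I -> ae_speed xi I v.
Proof. by apply: negligibleS => t /= /not_implyP[]. Qed.

Lemma negligible_pt (a : R) : mu.-negligible [set a].
Proof. apply/negligibleP => //; exact: lebesgue_measure_set1. Qed.

Lemma has_metric_derivative_near xi zeta t v :
  (\forall s \near t, xi s = zeta s) ->
  has_metric_derivative xi t v -> has_metric_derivative zeta t v.
Proof.
move=> E; rewrite /has_metric_derivative => h.
have Et : xi t = zeta t by exact: nbhs_singleton E.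
apply: cvg_trans h; apply: near_eq_cvg; apply: cvg_within; near=> s.
by rewrite /mdiff_quotient -Et; congr (mdist _ _ / _); near: s.
Unshelve. all: by end_near. Qed.

Lemma ae_speed_eq xi zeta I v : open I -> {in I, xi =1 zeta} ->
  ae_speed xi I v -> ae_speed zeta I v.
Proof.
move=> oI E; apply: negligibleS => t /= /not_implyP[It nt] /(_ It) dt.
apply: nt; move: dt; apply: has_metric_derivative_near; near=> s; apply: E; rewrite inE.
by near: s; exact: open_nbhs_nbhs.
Unshelve. all: by end_near. Qed.

Lemma ae_speed_shift xi (h : R) I v :
  ae_speed xi I v -> ae_speed (fun r => xi (r + h)) [set r | I (r + h)] v.
Proof.
move=> /(negligible_shift h); apply: negligibleS => t /= /not_implyP[It nt].
apply/not_implyP; split => // dt; apply: nt.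
apply/cvgrPdist_lt => e e0.
have /cvgrPdist_lt/(_ _ e0) [d /= d0 dP] := dt.
exists d => //= s; rewrite /ball/= => st snt.
have := dP (s + h); rewrite /= /mdiff_quotient opprD addrACA subrr addr0.
have -> : s + h - (t + h) = s - t by lra.
by apply => //; rewrite (inj_eq (addIr h)).
Qed.

Lemma ae_speed_cst (x : X) I : ae_speed (fun=> x) I 0.
Proof.
apply: aeW => t _; rewrite /has_metric_derivative /mdiff_quotient.
under eq_cvg do rewrite mdistxx mul0r.
exact: cvg_cst.
Qed.

Lemma has_metric_derivative_unique xi t u v :
  has_metric_derivative xi t u -> has_metric_derivative xi t v -> u = v.
Proof. by apply: cvg_unique. Qed.

Lemma metric_derivativeE xi t v :
  has_metric_derivative xi t v -> metric_derivative xi t = v.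
Proof. by apply/cvg_lim. Qed.

(** The value of [get] is determined: two speeds valid to the right of [h] share an interval of
    positive measure, hence a point at which both are the metric derivative. *)
Lemma right_speedE xi h e v :
  0 < e -> ae_speed xi `]h, h + e[ v -> right_speed xi h = v.
Proof.
move=> e0 hv; rewrite /right_speed; apply: get_unique; first by exists e.
move=> u [f f0 fu].
pose I : set R := `]h, h + Num.min e f[%classic.
have mpos : (0 < mu I)%E.
  rewrite lebesgue_measure_itv/= lte_fin ltrDl lt_min e0 f0 -EFinB lte_fin.
  by rewrite addrAC subrr add0r lt_min e0 f0.
have [t [dv du]] : exists t, has_metric_derivative xi t v /\
    has_metric_derivative xi t u.
  apply: contrapT => /forallNP N.
  have /negligibleP m0 : mu.-negligible I.
    apply: negligibleS (negligibleU hv fu) => t.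
    rewrite /I /= in_itv/= => /andP[ht].
    rewrite -ltrBlDl lt_min !ltrBlDl => /andP[te tf].
    have [dv|ndv] := pselect (has_metric_derivative xi t v).
      right => /(_ _) du; apply: (N t); split => //; apply: du.
      by rewrite in_itv/= ht.
    by left => dv; apply/ndv/dv; rewrite in_itv/= ht.
  by move: mpos; rewrite m0 ?ltxx//; exact: measurable_itv.
exact: has_metric_derivative_unique du dv.
Qed.

End speed.

(** * Arc length *)

Section arc_length.
Variables (R : realType) (X : metricType R).
Implicit Types (xi : R -> X) (p : seq R).

Lemma path_le_last (a : R) p : path <=%R a p -> a <= last a p.
Proof.
elim: p a => [|b p IH] a //= /andP[ab bp]; exact: le_trans (IH _ bp).
Qed.

Lemma polygonal_length_rcons xi a p x :
  polygonal_length xi a (rcons p x) =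
  polygonal_length xi a p + mdist (xi (last a p)) (xi x).
Proof. by elim: p a => [|b p IH] a /=; rewrite ?addr0 ?add0r// IH addrA. Qed.

Lemma polygonal_length_split xi (a r : R) p :
  path <=%R a p -> a <= r -> r <= last a p -> exists p1 p2,
  [/\ path <=%R a p1, last a p1 = r, path <=%R r p2, last r p2 = last a p &
      polygonal_length xi a p <= polygonal_length xi a p1 + polygonal_length xi r p2].
Proof.
elim: p a => [|b p IH] a /=.
  move=> _ ar ra; have <- : a = r by apply/eqP; rewrite eq_le ar ra.
  by exists [::], [::]; rewrite addr0.
move=> /andP[ab bp] ar rl; have [rb|br] := leP r b.
  exists [:: r], (b :: p); split => //=; rewrite ?ar ?rb//.
  by have := metric_triangle (xi a) (xi r) (xi b); lra.
have [p1 [p2 [h1 h2 h3 h4 h5]]] := IH b bp (ltW br) rl.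
by exists (b :: p1), p2; split => //=; rewrite ?ab// -addrA lerD2l.
Qed.

(** The edges of [p] form an ordered list of intervals of total length [last r p - r], so one [d]
    serves all polygonal lines. *)
Lemma abs_continuous_polygonal xi (a b e : R) : a <= b ->
  abs_continuous setT xi -> 0 < e ->
  exists2 d : R, 0 < d & forall r p, a <= r -> path <=%R r p ->
    last r p <= b -> last r p - r < d -> polygonal_length xi r p < e.
Proof.
move=> ab ac e0.
have [d d0 H] := abs_continuous_seq ab ac (@subsetT _ _) e0.
exists d => // r p ar rp lb ld.
pose s r p := zip (belast r p) p : seq (R * R).
have sP q u : path <=%R u q ->
    [/\ forall i, i \in s u q -> [&& u <= i.1, i.1 <= i.2 & i.2 <= last u q],
      pairwise (@before R) (s u q),
      \sum_(i <- s u q) (i.2 - i.1) = last u q - u &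
      \sum_(i <- s u q) mdist (xi i.1) (xi i.2) = polygonal_length xi u q].
  elim: q u => [|v q IH] u /=; first by rewrite !big_nil subrr.
  move=> /andP[uv vq]; have [h1 h2 h3 h4] := IH v vq; split.
  - move=> i; rewrite inE => /predU1P[->/=|/h1 /and3P[vi -> ->]].
      by rewrite lexx uv path_le_last.
    by rewrite (le_trans uv).
  - by rewrite h2 andbT; apply/allP => i /h1/and3P[].
  - by rewrite big_cons h3/=; lra.
  - by rewrite big_cons h4.
have [h1 h2 h3 h4] := sP p r rp; rewrite -h4; apply: H => //; last by rewrite h3.
by move=> i /h1; lra.
Qed.

(** [V] is the arc length from [s]. A time [rho t] with [V (rho t) = c * t] exists by the
    intermediate value theorem; any choice will do, since equal arc length forces equal points of
    the curve. *)
Lemma constant_speed_curve xi (s s' c e : R) : 0 < c -> s <= s' ->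
  abs_continuous setT xi ->
  (forall p, path <=%R s p -> last s p = s' -> polygonal_length xi s p <= e) ->
  exists (tau : R) (g : R -> X),
  [/\ 0 <= tau <= e / c, forall x y, mdist (g x) (g y) <= c * `|x - y|,
      g 0 = xi s, g tau = xi s' & ae_speed g `]0, tau[ c].
Proof.
move=> c0 ss' ac Le.
pose PL r := [set polygonal_length xi s p | p in
  [set p | path <=%R s p /\ last s p = r]].
pose V r := sup (PL r).
have hPL r : s <= r -> r <= s' -> has_sup (PL r).
  move=> sr rs'; split.
    by exists (polygonal_length xi s [:: r]), [:: r] => //=; rewrite sr.
  exists e => _ [p [sp lp] <-].
  apply: le_trans (Le (rcons p s') _ _); last by rewrite last_rcons.
    by rewrite polygonal_length_rcons lerDl mdist_ge0.
  by rewrite rcons_path sp lp.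
have plV p : path <=%R s p -> last s p <= s' -> polygonal_length xi s p <= V (last s p).
  move=> sp ps'; apply: ub_le_sup; last by exists p.
  by have [] := hPL (last s p) (path_le_last sp) ps'.
have V0 : V s = 0.
  apply/eqP; rewrite eq_le; apply/andP; split; last exact: (plV [::]).
  apply: ge_sup; first by have [] := hPL s (lexx s) ss'.
  move=> _ [p [+ +] <-]; elim: p => [|b p IH] //= /andP[sb bp] lb.
  have bs : b = s.
    by apply/eqP; rewrite eq_le sb andbT -lb path_le_last.
  by move: bp lb; rewrite bs mdistxx add0r; exact: IH.
have VD r r' : s <= r -> r <= r' -> r' <= s' -> V r + mdist (xi r) (xi r') <= V r'.
  move=> sr rr' r's'; rewrite -lerBrDr; apply: ge_sup.
    by have [] := hPL r sr (le_trans rr' r's').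
  move=> _ [p [sp lp] <-]; rewrite lerBrDr.
  have := plV (rcons p r'); rewrite last_rcons polygonal_length_rcons lp.
  by apply => //; rewrite rcons_path sp lp.
have Vh r r' : s <= r -> r <= r' -> r' <= s' -> V r <= V r'.
  by move=> sr rr' r's'; apply: le_trans (VD r r' sr rr' r's'); rewrite lerDl mdist_ge0.
have distV r r' : s <= r <= s' -> s <= r' <= s' -> mdist (xi r) (xi r') <= `|V r - V r'|.
  move=> /andP[sr rs] /andP[sr' rs']; have [rr'|/ltW rr'] := leP r r'.
    by have := VD r r' sr rr' rs'; have := Vh r r' sr rr' rs' => ? ?;
      rewrite ler0_norm; lra.
  by have := VD r' r sr' rr' rs; have := Vh r' r sr' rr' rs => ? ?;
      rewrite metric_sym ger0_norm; lra.
(* Splitting a polygon that ends at [r'] at the time [r] bounds its length by [V r] plus that of a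
   short polygon, small by absolute continuity. *)
have Vuc f : 0 < f -> exists2 d, 0 < d & forall r r', s <= r -> r <= r' ->
    r' <= s' -> r' - r < d -> V r' <= V r + f.
  move=> f0; have [d d0 dP] := abs_continuous_polygonal ss' ac f0.
  exists d => // r r' sr rr' r's' rd.
  apply: ge_sup; first by have [] := hPL r' (le_trans sr rr') r's'.
  move=> _ [p [sp lp] <-].
  have [|p1 [p2 [h1 h2 h3 h4 h5]]] := polygonal_length_split xi sp sr.
    by rewrite lp.
  apply: (le_trans h5); apply: lerD; first by rewrite -h2 plV// h2 (le_trans rr').
  by rewrite ltW// dP// h4 lp.
have Vc : {within `[s, s'], continuous V}.
  apply/subspace_continuousP => x /=; rewrite in_itv/= => /andP[sx xs'].
  apply/cvgrPdist_lt => f f0.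
  have [d d0 dP] := Vuc (f / 2) (divr_gt0 f0 (ltr0Sn _ _)).
  exists d => //= y; rewrite /from_subspace /ball/= in_itv/= => xyd /andP[sy ys'].
  have [xy|/ltW yx] := leP x y.
    have := Vh x y sx xy ys'; have := dP x y sx xy ys'.
    move: xyd; rewrite ler0_norm ?subr_le0// => h1 h2 h3.
    by rewrite ler0_norm ?subr_le0//; have := h2 ltac:(lra); lra.
  have := Vh y x sy yx xs'; have := dP y x sy yx xs'.
  move: xyd; rewrite ger0_norm ?subr_ge0// => h1 h2 h3.
  by rewrite ger0_norm ?subr_ge0//; have := h2 h1; lra.
pose tau := V s' / c.
have Vs'0 : 0 <= V s' by rewrite -V0 Vh.
have tau0 : 0 <= tau by rewrite divr_ge0// ltW.
have ctau : c * tau = V s' by rewrite /tau mulrC divfK// gt_eqF.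
have /choice[rho rhoP] t : exists r, 0 <= t <= tau -> s <= r <= s' /\ V r = c * t.
  have [/andP[t0 tt]|//] := pselect (is_true (0 <= t <= tau)); last by exists 0.
  have [|r rss' Vr] := @IVT R V s s' (c * t) ss' Vc.
    rewrite V0 ge_min le_max mulr_ge0 ?(ltW c0)//= -ctau.
    by rewrite (ler_pM2l c0) tt orbT.
  by exists r => _; rewrite Vr; split => //; move: rss'; rewrite in_itv.
(* Clamping to [[0, tau]] makes [g] Lipschitz on the whole line. *)
pose cl x := Num.max 0 (Num.min x tau).
have clb x : 0 <= cl x <= tau.
  by rewrite /cl le_max lexx/= ge_max tau0 ge_min lexx orbT.
have clid x : 0 <= x <= tau -> cl x = x.
  by move=> /andP[x0 xt]; rewrite /cl min_l// max_r.
have cl_lip x y : `|cl x - cl y| <= `|x - y|.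
  wlog xy : x y / x <= y.
    by move=> H; have [/H//|/ltW/H] := leP x y; rewrite distrC (distrC x).
  rewrite (ler0_norm (x := x - y)) ?subr_le0// ler_norml /cl.
  by case: (leP x tau) => ?; case: (leP y tau) => ?; case: (leP 0 x) => ?;
    case: (leP 0 y) => ?; rewrite ?(max_r tau0); lra.
pose g x := xi (rho (cl x)).
have gV r : s <= r <= s' -> g (V r / c) = xi r.
  move=> srs; have /andP[sr rs] := srs.
  have Vrc : 0 <= V r / c <= tau.
    by rewrite divr_ge0 ?(ltW c0)//= -?V0 ?Vh// ler_wpM2r ?invr_ge0 ?(ltW c0)// Vh.
  rewrite /g clid//; have [h1 h2] := rhoP _ Vrc.
  apply: mdist_positivity; apply/eqP; rewrite eq_le mdist_ge0 andbT.
  apply: (le_trans (distV _ _ h1 srs)).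
  by rewrite h2 mulrC divfK ?gt_eqF// subrr normr0.
have g_lip x y : mdist (g x) (g y) <= c * `|x - y|.
  have [h1 h2] := rhoP _ (clb x); have [h3 h4] := rhoP _ (clb y).
  apply: (le_trans (distV _ _ h1 h3)); rewrite h2 h4 -mulrBr normrM gtr0_norm//.
  by rewrite ler_wpM2l// ltW.
exists tau, g; split => //.
- rewrite tau0 ler_wpM2r ?invr_ge0 ?(ltW c0)//; apply: ge_sup.
    by have [] := hPL s' ss' (lexx _).
  by move=> _ [p [sp lp] <-]; exact: Le.
- by rewrite -(gV s) ?lexx// V0 mul0r.
- by rewrite gV// ss' lexx.
- apply: full_length_ae_speed => //; first exact: ltW.
  move=> f f0; rewrite ctau.
  (* A polygon of nearly maximal length, its vertices moved to the times [V r / c], witnesses the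
     full length of [g]. *)
  have [_ [p [sp lp] <-] pV] := sup_adherent f0 (hPL s' ss' (lexx _)).
  exists [seq V r / c | r <- p].
  have pathV q u : s <= u -> path <=%R u q -> last u q <= s' ->
      path <=%R (V u / c) [seq V r / c | r <- q] /\
      polygonal_length g (V u / c) [seq V r / c | r <- q] = polygonal_length xi u q.
    elim: q u => [|v q IH] u //= su /andP[uv vq] lq.
    have vl := path_le_last vq.
    have [h1 ->] := IH v (le_trans su uv) vq lq; rewrite h1.
    rewrite !gV ?su ?(le_trans su uv) ?(le_trans uv (le_trans vl lq)) ?(le_trans vl lq)//.
    by rewrite ler_wpM2r ?invr_ge0 ?(ltW c0)// Vh// (le_trans vl).
  have [|h1 h2] := pathV p s (lexx s) sp; first by rewrite lp.
  move: h1 h2; rewrite V0 mul0r => h1 h2; split => //.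
    transitivity (V (last s p) / c); last by rewrite lp.
    by rewrite -(last_map (fun r => V r / c)) /= V0 mul0r.
  by rewrite h2 ltW.
Qed.

End arc_length.

(** * Admissible curves *)

Section admissible_curves.
Variables (R : realType) (X : metricType R) (H : X -> R -> R).
Local Notation mu := (@lebesgue_measure R).
Implicit Types (xi zeta : R -> X) (I J : set R).

Definition admissible_piece (I : set R) xi := exists v : R,
  [/\ 0 <= v, ae_speed xi I v,
    (forall r, I r -> lagrangian H (xi r) v \is a fin_num) &
    {within I, continuous (fun r => lagrangian H (xi r) v)}].

(** An inductive form of the list of break points, which permits induction on the pieces and speaks
    of the tail from any [a]. *)
Inductive admissible_after xi (a : R) : Prop :=
| admissible_last : admissible_piece `[a, +oo[ xi -> admissible_after xi a
| admissible_cons b : a < b -> admissible_piece `[a, b] xi ->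
    admissible_after xi b -> admissible_after xi a.

Lemma admissibleP xi : admissible H xi <->
  abs_continuous `[0, +oo[ xi /\ admissible_after xi 0.
Proof.
split=> [[ac [rs prs adm]]|[ac adm]]; split => //.
  have {}adm (I : interval R) :
    I \in pieces 0 rs +oo%O -> admissible_piece [set` I] xi by exact: adm.
  elim: rs 0 prs adm {ac} => [|b rs IH] a /=.
    move=> _ /(_ `[a, +oo[); rewrite inE eqxx => /(_ isT) adm.
    exact: admissible_last.
  move=> /andP[ab brs] adm; apply: (admissible_cons ab).
    by apply: adm; rewrite inE eqxx.
  by apply: IH => // I Ib; apply: adm; rewrite inE Ib orbT.
suff : exists2 rs : seq R, path <%R 0 rs &
  forall I : interval R, I \in pieces 0 rs +oo%O -> admissible_piece [set` I] xi by [].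
elim: adm => {ac} [a adm|a b ab adm _ [rs prs IH]].
  by exists [::] => // I; rewrite inE => /eqP ->.
by exists (b :: rs) => /= [|I]; rewrite ?ab// inE => /predU1P[->|/IH].
Qed.

Lemma admissible_pieceS I J xi : J `<=` I ->
  admissible_piece I xi -> admissible_piece J xi.
Proof.
move=> JI [v [v0 sv fv cv]]; exists v; split => //.
- exact: ae_speedS sv.
- by move=> r /JI/fv.
- exact: continuous_subspaceW cv.
Qed.

(** Equality on the interval does not control difference quotients at its end points, but these are
    null, and the interior is open. *)
Lemma admissible_piece_eq (a : R) (b : itv_bound R) xi zeta :
  {in [set` Interval (BLeft a) b], xi =1 zeta} ->
  admissible_piece [set` Interval (BLeft a) b] xi ->
  admissible_piece [set` Interval (BLeft a) b] zeta.
Proof.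
move=> E [v [v0 sv fv cv]]; exists v; split => //.
- have Ib : [set` Interval (BLeft a) b] `<=`
      [set` Interval (BLeft a) b]° `|` ([set a] `|` [set x | b = BRight x]).
    case: b {E sv fv cv} => [[] b|[]] x; rewrite ?interior_itv /= !in_itv/= ?andbF// ?andbT.
    + move=> /andP[ax xb]; case: (eqVneq x a) => [->|xa]; first by right; left.
      by left; rewrite ?in_itv/= ?andbT lt_neqAle eq_sym xa ax.
    + move=> /andP[ax xb]; case: (eqVneq x a) => [->|xa]; first by right; left.
      case: (eqVneq x b) => [->|xb']; first by right; right.
      by left; rewrite ?in_itv/= !lt_neqAle eq_sym xa ax xb' xb.
    + move=> ax; case: (eqVneq x a) => [->|xa]; first by right; left.
      by left; rewrite ?in_itv/= ?andbT lt_neqAle eq_sym xa ax.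
  apply: ae_speedS Ib _; apply: ae_speedU.
    apply: (ae_speed_eq _ _ (ae_speedS (@interior_subset _ _) sv)).
      exact: open_interior.
    by move=> x; rewrite inE => /interior_subset xI; apply: E; rewrite inE.
  apply: ae_speedU; apply: ae_speed_negligible; first exact: negligible_pt.
  case: b {E sv fv cv} => [[] b|[]]; try by apply: negligibleS (@negligible_set0 _ _ _ mu).
  by apply: negligibleS (negligible_pt b) => x [->].
- by move=> r rI; rewrite -E ?inE//; exact: fv.
- apply: subspace_eq_continuous cv => r rI; by rewrite /from_subspace E.
Qed.

Lemma admissible_piece_shift I J xi (h : R) :
  (forall r, J r -> I (r + h)) -> admissible_piece I xi ->
  admissible_piece J (fun r => xi (r + h)).
Proof.
move=> JI [v [v0 sv fv cv]]; exists v; split => //.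
- by apply: ae_speedS (ae_speed_shift h sv) => r /JI.
- by move=> r /JI/fv.
- apply/subspace_continuousP => x Jx.
  have := (subspace_continuousP _ _).1 cv (x + h) (JI _ Jx).
  apply: cvg_comp => A [d /= d0 dA].
  exists d => //= y xy Jy; apply: dA; last exact: JI.
  by rewrite /ball/= opprD addrACA subrr addr0.
Qed.

Lemma admissible_after_eq xi zeta (a : R) : {in `[a, +oo[, xi =1 zeta} ->
  admissible_after xi a -> admissible_after zeta a.
Proof.
move=> E adm; elim: adm E => {a} [a ad|a b ab ad _ IH] E.
  apply: admissible_last; apply: admissible_piece_eq ad => r.
  by rewrite inE; exact: E.
apply: (admissible_cons ab).
  apply: (@admissible_piece_eq a (BRight b)) ad => r; rewrite inE/= => rab; apply: E.
  by move: rab; rewrite !in_itv/= => /andP[->].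
apply: IH => r rb; apply: E; move: rb; rewrite !in_itv/= !andbT.
by apply: le_trans; exact: ltW.
Qed.

Lemma admissible_after_shift xi (a h : R) : admissible_after xi (a + h) ->
  admissible_after (fun r => xi (r + h)) a.
Proof.
move=> adm; move E : (a + h) adm => ah adm; elim: adm a E => {ah} [ah adm|ah b ab adm _ IH] a E.
  apply: admissible_last; apply: admissible_piece_shift adm => r /=.
  by rewrite !in_itv/= -E lerD2r.
apply: (@admissible_cons _ _ (b - h)); first by rewrite ltrBrDr E.
  apply: admissible_piece_shift adm => r /=.
  by rewrite !in_itv/= -E lerD2r lerBrDr.
by apply: IH; rewrite subrK.
Qed.

Lemma admissible_after_le xi (a b : R) : a <= b ->
  admissible_after xi a -> admissible_after xi b.
Proof.
move=> ab adm; elim: adm ab => {a} [a adm|a c ac adm admc IH] ab.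
  apply: admissible_last; apply: admissible_pieceS adm => x /=.
  by rewrite !in_itv/= !andbT; exact: le_trans.
have [/IH//|bc] := leP c b.
apply: (admissible_cons bc) => //; apply: admissible_pieceS adm => x /=.
by rewrite !in_itv/= => /andP[bx ->]; rewrite (le_trans ab).
Qed.

Lemma admissible_after_cat xi zeta (a h : R) : a < h ->
  {in `[a, h], xi =1 zeta} -> admissible_after xi a -> admissible_after zeta h ->
  admissible_after zeta a.
Proof.
move=> ah E adm admh; elim: adm ah E => {a} [a adm|a c ac adm admc IH] ah E.
  apply: (admissible_cons ah) => //.
  apply: (@admissible_piece_eq a (BRight h) xi).
    by move=> x; rewrite inE; exact: E.
  by apply: admissible_pieceS adm => x /=; rewrite !in_itv/= => /andP[->].
have [hc|ch] := leP h c.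
  apply: (admissible_cons ah) => //.
  apply: (@admissible_piece_eq a (BRight h) xi).
    by move=> x; rewrite inE; exact: E.
  apply: admissible_pieceS adm => x /=; rewrite !in_itv/= => /andP[->] /=.
  by move=> /le_trans; apply.
apply: (admissible_cons ac).
  apply: (@admissible_piece_eq a (BRight c) xi) => //.
  move=> x; rewrite inE/= in_itv/= => /andP[ax xc]; apply: E.
  by rewrite in_itv/= ax (le_trans xc)// ltW.
apply: IH => // x; rewrite in_itv/= => /andP[cx xh]; apply: E.
by rewrite in_itv/= xh andbT (le_trans _ cx)// ltW.
Qed.

Lemma admissible_shift xi (h : R) : 0 <= h ->
  admissible H xi -> admissible H (fun r => xi (r + h)).
Proof.
move=> h0 /admissibleP[ac adm]; apply/admissibleP; split.
  apply: (abs_continuous_shift _ ac) => r /=.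
  by rewrite !in_itv/= !andbT subr_ge0; exact: le_trans.
by apply: admissible_after_shift; rewrite add0r; exact: admissible_after_le adm.
Qed.

Definition concat xi (h : R) zeta : R -> X :=
  fun r => if r <= h then xi r else zeta (r - h).

Lemma concat_right xi h zeta r : zeta 0 = xi h -> 0 <= r ->
  concat xi h zeta (r + h) = zeta r.
Proof.
move=> E; rewrite le_eqVlt /concat => /predU1P[<-|r0].
  by rewrite add0r lexx.
by rewrite gerDr leNgt r0 addrK.
Qed.

(** The first part is either one piece, which suits constant-speed curves whose speed is known only
    up to [h], or the beginning of an admissible curve, as dynamic programming requires. *)
Lemma admissible_concat xi (h : R) zeta : 0 <= h -> zeta 0 = xi h ->
  abs_continuous `[0, h] xi ->
  admissible_piece `[0, h] xi \/ admissible_after xi 0 ->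
  admissible H zeta -> admissible H (concat xi h zeta).
Proof.
move=> h0 E acx admx /admissibleP[ac adm]; apply/admissibleP.
have acr : abs_continuous `[h, +oo[ (concat xi h zeta).
  apply: (@abs_continuous_eq _ _ _ (fun r => zeta (r + - h))).
    move=> r; rewrite inE/= in_itv/= andbT => hr.
    by rewrite -[in RHS](subrK h r) concat_right// subr_ge0.
  apply: abs_continuous_shift ac => r /=.
  by rewrite opprK !in_itv/= !andbT; lra.
have admr : admissible_after (concat xi h zeta) h.
  have := @admissible_after_shift zeta h (- h); rewrite subrr => /(_ adm).
  move=> {}adm.
  have Eq : {in `[h, +oo[, (fun r => zeta (r - h)) =1 concat xi h zeta}.
    move=> r; rewrite in_itv/= andbT => hr.
    by rewrite -[in RHS](subrK h r) concat_right// subr_ge0.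
  exact: admissible_after_eq Eq adm.
move: h0; rewrite le_eqVlt => /predU1P[h0|h0]; first by rewrite h0.
have Eq : {in `[0, h], xi =1 concat xi h zeta}.
  by move=> r; rewrite in_itv/= /concat => /andP[_ ->].
split.
  apply: (@abs_continuous_cat _ _ _ _ h).
    apply: (@abs_continuousS _ _ _ `[0, h]).
      by move=> r [/=]; rewrite !in_itv/= andbT => -> ->.
    by apply: abs_continuous_eq acx => r; rewrite inE; exact: Eq.
  by apply: abs_continuousS acr => r [].
case: admx => admx.
  apply: (admissible_cons h0) => //.
  by apply: (@admissible_piece_eq 0 (BRight h)) admx => r; rewrite inE; exact: Eq.
exact: admissible_after_cat h0 Eq admx admr.
Qed.

End admissible_curves.

(** * The cost of an admissible curve *)

Section integrals.
Variable R : realType.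
Local Notation mu := (@lebesgue_measure R).

Lemma integrable_setU (A B : set (measurableTypeR R)) (f : measurableTypeR R -> \bar R) :
  measurable A -> measurable B ->
  mu.-integrable A f -> mu.-integrable B f -> mu.-integrable (A `|` B) f.
Proof.
move=> mA mB /integrableP[mfA iA] /[dup] iB' /integrableP[mfB iB].
have mf : measurable_fun (A `|` B) f by apply/measurable_funU.
apply/integrableP; split => //.
have mBA : measurable (B `\` A) by exact: measurableD.
have AB : A `|` B = A `|` (B `\` A).
  apply/seteqP; split => x [|]; [by left| |by left|by case; right].
  by have [Ax|nAx] := pselect (A x); [left|right].
rewrite AB ge0_integral_setU//=; last 2 first.
- by rewrite -AB; apply: measurableT_comp.
- by rewrite disj_set2E setDIK eqxx.
apply: lte_add_pinfty => //; apply: le_lt_trans iB.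
by apply: ge0_subset_integral => //; apply: measurableT_comp.
Qed.

Lemma continuous_primitive (k : R -> R) (a : R) : continuous k ->
  exists F : R -> R, forall x, a < x -> is_derive x 1 F (k x) /\
    forall y, x <= y -> F y - F x = \int[mu]_(r in `[x, y]) k r.
Proof.
move=> ck; exists (fun x => \int[mu]_(r in `[a, x]) k r) => x ax.
have ik u v : mu.-integrable `[u, v] (EFin \o k).
  apply: continuous_compact_integrable; first exact: segment_compact.
  exact: continuous_subspaceT.
split.
  have [|//|d1 d2] := @continuous_FTC1 _ k (BLeft a) x (x + 1) _ (ik _ _) _ (ck x).
    by rewrite ltrDl.
  by rewrite -d2 derive1E; exact/derivableP.
move=> y xy; rewrite Rintegral_itvB// ?bnd_simp ?ltW//.
by rewrite Rintegral_itv_obnd_cbnd//; apply: integrableS (ik x y) => //;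
  exact: subset_itv_oc_cc.
Qed.

Lemma integrable_cst_itv (l r C : R) : mu.-integrable `[l, r[ (EFin \o cst C).
Proof.
have ic : mu.-integrable `[l, r] (EFin \o cst C).
  apply: continuous_compact_integrable; first exact: segment_compact.
  by apply: continuous_subspaceT => x; exact: cvg_cst.
by apply: integrableS ic => //; exact: subset_itv_co_cc.
Qed.

Lemma Rintegral_cst_itv (l r C : R) : l <= r -> \int[mu]_(x in `[l, r[) C = C * (r - l).
Proof.
move=> lr; rewrite Rintegral_cst//; congr (C * _).
rewrite [X in fine X]lebesgue_measure_itv /= lte_fin; case: ltP => //= rl.
by have -> : r = l by [apply/eqP; rewrite eq_le rl lr]; rewrite subrr.
Qed.

End integrals.

Section cost.
Variables (R : realType) (X : metricType R) (H : X -> R -> R).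
Local Notation mu := (@lebesgue_measure R).
Implicit Types (xi zeta : R -> X).

(* The integrand of the value function, with the metric derivative replaced by
   the right speed: the two agree almost everywhere, and on a piece [l, r] of an
   admissible curve [running_cost] is continuous except possibly at [r]. *)
Definition running_cost xi (r : R) : R := fine (lagrangian H (xi r) (right_speed xi r)).

Definition cost xi (t : R) : R := \int[mu]_(r in `[0, t]) running_cost xi r.

Lemma admissible_right xi (a h : R) : a <= h -> admissible_after H xi a ->
  exists2 e : R, 0 < e & admissible_piece H `[h, h + e] xi.
Proof.
move=> ah adm; elim: adm ah => {a} [a adm|a b ab adm _ IH] ah.
  exists 1 => //; apply: admissible_pieceS adm => x /=.
  by rewrite !in_itv/= andbT => /andP[/(le_trans ah)].
have [/IH//|hb] := leP b h.
exists (b - h); first by rewrite subr_gt0.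
apply: admissible_pieceS adm => x /=; rewrite !in_itv/= addrC subrK => /andP[hx ->].
by rewrite (le_trans ah).
Qed.

(** Spreads estimates made on single pieces, such as integrability or the lower bound on the cost,
    over several break points. *)
Lemma admissible_pieces_ind xi (P : R -> R -> Prop) :
  (forall l m r, l <= m -> m <= r -> P l m -> P m r -> P l r) ->
  (forall l r, l <= r -> admissible_piece H `[l, r] xi -> P l r) ->
  forall a l r, a <= l -> l <= r -> admissible_after H xi a -> P l r.
Proof.
move=> Padd Ppiece a l r al lr adm; elim: adm l al lr => {a} [a adm|a b ab adm _ IH] l al lr.
  apply: Ppiece => //; apply: admissible_pieceS adm => x /=.
  by rewrite !in_itv/= andbT => /andP[/(le_trans al)].
have [bl|lb] := leP b l; first exact: IH.
have sub x : l <= x -> x <= b -> `[a, b]%classic x.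
  by move=> lx xb; rewrite /= in_itv/= xb (le_trans al).
have [rb|br] := leP r b.
  apply: Ppiece => //; apply: admissible_pieceS adm => x /=.
  by rewrite in_itv/= => /andP[lx xr]; apply: sub => //; exact: le_trans rb.
apply: (Padd l b r); rewrite ?ltW//.
  apply: Ppiece; first exact: ltW.
  by apply: admissible_pieceS adm => x /=; rewrite in_itv/= => /andP[lx xb]; exact: sub.
by apply: IH; rewrite // ltW.
Qed.

Section one_piece.
Variables (xi : R -> X) (l r v : R).
Hypotheses (lr : l < r) (speed_v : ae_speed xi `[l, r] v)
  (fin_v : forall s, `[l, r]%classic s -> lagrangian H (xi s) v \is a fin_num)
  (cont_v : {within `[l, r], continuous (fun s => lagrangian H (xi s) v)}).

Let k s := fine (lagrangian H (xi s) v).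

Lemma right_speed_piece s : l <= s < r -> right_speed xi s = v.
Proof.
move=> /andP[ls sr]; apply: (@right_speedE _ _ _ _ (r - s)).
  by rewrite subr_gt0.
apply: ae_speedS speed_v => x /=; rewrite !in_itv/= addrC subrK => /andP[sx xr].
by rewrite (le_trans ls) ltW.
Qed.

Lemma running_cost_piece s : l <= s < r -> running_cost xi s = k s.
Proof. by move=> lsr; rewrite /running_cost right_speed_piece. Qed.

Lemma piece_cost_continuous : {within `[l, r], continuous k}.
Proof.
apply/subspace_continuousP => x xlr.
suff : lagrangian H (xi s) v @[s --> within `[l, r] (nbhs x)] --> (k x)%:E.
  by move=> /fine_cvg.
rewrite /k fineK; last exact: fin_v.
exact: (subspace_continuousP _ _).1 cont_v x xlr.
Qed.

Lemma running_cost_piece_integrable : mu.-integrable `[l, r] (EFin \o running_cost xi).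
Proof.
have ik : mu.-integrable `[l, r] (EFin \o k).
  apply: continuous_compact_integrable; first exact: segment_compact.
  exact: piece_cost_continuous.
(* At [r] the right speed belongs to the next piece, so this point is split off as a null set. *)
rewrite -(@setUitv1 _ _ _ _ true) ?bnd_simp ?ltW//; apply: integrable_setU => //; last first.
  apply: null_set_integrable => //; first exact: measurable_fun_set1.
  exact: lebesgue_measure_set1.
have ik' : mu.-integrable `[l, r[ (EFin \o k).
  by apply: (integrableS _ _ _ ik) => //; exact: subset_itv_co_cc.
apply: eq_integrable ik' => // s; rewrite inE/= in_itv/= => slr.
by rewrite running_cost_piece.
Qed.

Lemma lagrangian_ae_piece : {ae mu, forall s, `[l, r]%classic s ->
  lagrangian H (xi s) (metric_derivative xi s) = (running_cost xi s)%:E}.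
Proof.
apply: negligibleS (negligibleU speed_v (negligible_pt r)) => s /= /not_implyP[].
rewrite ?in_itv/= => /andP[ls sr] ne.
have [->|snr] := eqVneq s r; [by right|left].
have lsr : l <= s <= r by rewrite ls.
rewrite /= ?in_itv/= lsr => /(_ isT) ds; apply: ne.
rewrite (metric_derivativeE ds) running_cost_piece ?ls ?lt_neqAle ?snr//.
by rewrite fineK// fin_v//= in_itv/= lsr.
Qed.

End one_piece.

Lemma running_cost_integrable xi (a l r : R) : admissible_after H xi a ->
  a <= l -> l <= r -> mu.-integrable `[l, r] (EFin \o running_cost xi).
Proof.
move=> adm al lr.
apply: (@admissible_pieces_ind xi
  (fun l r => mu.-integrable `[l, r] (EFin \o running_cost xi)) _ _ a) => //.
- move=> u m w um mw iu iw.
  rewrite (_ : `[u, w]%classic = `[u, m] `|` `[m, w]); first exact: integrable_setU.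
  apply/seteqP; split => x /=; rewrite !in_itv/=.
    by move=> /andP[-> ->]; rewrite andbT; case: (leP x m) => h; [left|right; exact: ltW].
  by case=> /andP[h1 h2]; apply/andP; split; lra.
- move=> u w; rewrite le_eqVlt => /predU1P[->|uw] [v [v0 sv fv cv]].
    rewrite set_itv1; apply: null_set_integrable => //; first exact: measurable_fun_set1.
    exact: lebesgue_measure_set1.
  exact: running_cost_piece_integrable uw sv fv cv.
Qed.

Lemma costB xi (s t : R) : admissible_after H xi 0 -> 0 <= s -> s <= t ->
  cost xi t - cost xi s = \int[mu]_(r in `[s, t]) running_cost xi r.
Proof.
move=> adm s0 st; rewrite /cost Rintegral_itvB ?bnd_simp//.
- rewrite Rintegral_itv_obnd_cbnd//.
  apply: integrableS (running_cost_integrable adm s0 st) => //.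
  exact: subset_itv_oc_cc.
- by apply: running_cost_integrable adm _ _ => //; exact: le_trans st.
Qed.

Lemma cost0 xi : cost xi 0 = 0.
Proof. by rewrite /cost set_itv1 Rintegral_set1. Qed.

Lemma cost_integralE xi (t : R) : admissible_after H xi 0 -> 0 <= t ->
  (\int[mu]_(r in `[0%R, t]) lagrangian H (xi r) (metric_derivative xi r))%E =
  (cost xi t)%:E.
Proof.
move=> adm t0; rewrite /cost /Rintegral fineK; last first.
  by apply: integrable_fin_num => //; exact: running_cost_integrable adm _ _.
apply: ae_eq_integral_nonmeasurable.
apply: (@admissible_pieces_ind xi (fun l r => {ae mu, forall s, `[l, r]%classic s ->
  lagrangian H (xi s) (metric_derivative xi s) = (running_cost xi s)%:E}) _ _ 0) => //.
- move=> u m w um mw iu iw; apply: negligibleS (negligibleU iu iw) => x /= /not_implyP[].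
  rewrite ?in_itv/= => /andP[ux xw] nx; have [xm|mx] := leP x m; [left|right].
    by move=> /= h; apply/nx/h; rewrite ux.
  by move=> /= h; apply/nx/h; rewrite (ltW mx) xw.
- move=> u w; rewrite le_eqVlt => /predU1P[->|uw] [v [v0 sv fv cv]].
    apply: negligibleS (negligible_pt w) => x /= /not_implyP[].
    by rewrite ?in_itv/= => /andP[wx xw] _; apply/eqP; rewrite eq_le xw wx.
  exact: lagrangian_ae_piece sv fv.
Qed.

Lemma cost_continuous xi (b : R) : admissible_after H xi 0 -> 0 <= b ->
  {within `[0, b], continuous (cost xi)}.
Proof.
move=> adm b0; apply: parameterized_integral_continuous => //.
exact: running_cost_integrable adm _ _.
Qed.

(* Unlike the cost, [F] is differentiable on both sides of [h]. *)
Lemma cost_right_primitive xi (h : R) : admissible_after H xi 0 -> 0 <= h ->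
  exists (e : R) (F k : R -> R),
  [/\ 0 < e, continuous k, k h = running_cost xi h,
    lagrangian H (xi h) (right_speed xi h) = (running_cost xi h)%:E &
    (forall x, h - 1 < x -> is_derive x 1 F (k x)) /\
    (forall s, h <= s < h + e -> cost xi s - cost xi h = F s - F h)].
Proof.
move=> adm h0; have [e e0 [v [v0 sv fv cv]]] := admissible_right h0 adm.
have heh : h < h + e by rewrite ltrDl.
have hh : `[h, h + e]%classic h by rewrite /= in_itv/= lexx ltW.
have kc := piece_cost_continuous fv cv.
(* Clamping to [[h, h + e]] extends the Lagrangian along the piece to a continuous function on the
   line; the primitive starts at [h - 1], which makes [h] interior. *)
pose cl x := Num.max h (Num.min x (h + e)).
have clc : continuous cl.
  move=> x; apply: (@continuous_max _ _ (cst h) (fun x => Num.min x (h + e))).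
    exact: cvg_cst.
  by apply: (@continuous_min _ _ id (cst (h + e))); [exact: cvg_id|exact: cvg_cst].
have clh x : `[h, h + e]%classic (cl x).
  by rewrite /= in_itv/= /cl le_max lexx/= ge_max (ltW heh) ge_min lexx orbT.
have clid x : h <= x <= h + e -> cl x = x.
  by move=> /andP[hx xh]; rewrite /cl min_l// max_r.
pose k x := fine (lagrangian H (xi (cl x)) v).
have ck : continuous k.
  move=> x; have := (subspace_continuousP _ _).1 kc (cl x) (clh x).
  apply: cvg_comp => A [d /= d0 dA].
  have /cvgrPdist_lt/(_ _ d0) [f /= f0 fP] := clc x.
  by exists f => //= y xy; apply: dA; [exact: fP|exact: clh].
have rk s : h <= s < h + e -> running_cost xi s = k s.
  move=> /andP[hs she]; rewrite (running_cost_piece sv) ?hs//.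
  by rewrite /k clid// hs ltW.
have [F FP] := continuous_primitive (h - 1) ck.
exists e, F, k; split => //.
- by rewrite rk ?lexx.
- rewrite (right_speed_piece sv) ?lexx// (running_cost_piece sv) ?lexx//.
  by rewrite fineK ?fv.
- split=> [x /FP[]//|s /andP[hs she]]; rewrite costB//.
  have [|_ ->//] := FP h; first by rewrite ltrBlDr ltrDl.
  by apply: eq_Rintegral => x; rewrite inE/= in_itv/= => /andP[hx xs];
    rewrite rk// hx (le_lt_trans xs).
Qed.

Lemma running_cost_eq xi zeta (h e : R) : admissible_after H xi 0 -> 0 <= h ->
  0 < e -> {in `[h, h + e[, xi =1 zeta} -> running_cost xi h = running_cost zeta h.
Proof.
move=> adm h0 e0 E; have [f f0 [v [v0 sv fv cv]]] := admissible_right h0 adm.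
rewrite /running_cost E ?in_itv/= ?lexx ?ltrDl//; congr (fine (lagrangian _ _ _)).
pose d := Num.min e f; have d0 : 0 < d by rewrite lt_min e0.
have sd : ae_speed xi `]h, h + d[ v.
  apply: ae_speedS sv => x /=; rewrite !in_itv/= => /andP[hx].
  by rewrite -ltrBlDl lt_min !ltrBlDl => /andP[_ xf]; rewrite !ltW.
rewrite (right_speedE d0 sd); apply/esym/(@right_speedE _ _ _ _ d) => //.
apply: ae_speed_eq sd; first exact: interval_open.
move=> x; rewrite inE/= in_itv/= => /andP[hx].
rewrite -ltrBlDl lt_min !ltrBlDl => /andP[xe _].
by apply: E; rewrite in_itv/= xe ltW.
Qed.

Lemma running_cost_shift xi (h r : R) : admissible H xi -> 0 <= h -> 0 <= r ->
  running_cost (fun s => xi (s + h)) r = running_cost xi (r + h).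
Proof.
move=> /admissibleP[_ adm] h0 r0; rewrite /running_cost; congr (fine (lagrangian _ _ _)).
have [e e0 [v [v0 sv fv cv]]] := admissible_right (addr_ge0 r0 h0) adm.
rewrite [RHS](@right_speedE _ _ _ _ e v) => //; last first.
  by apply: ae_speedS sv => x /=; rewrite !in_itv/= => /andP[/ltW -> /ltW].
apply: (@right_speedE _ _ _ _ e) => //; apply: ae_speedS (ae_speed_shift h sv).
by move=> x /=; rewrite !in_itv/= => /andP[rx xr]; apply/andP; split; lra.
Qed.

Lemma cost_shift xi (h s : R) : admissible H xi -> 0 <= h -> 0 <= s ->
  cost (fun r => xi (r + h)) s = cost xi (s + h) - cost xi h.
Proof.
move=> adm h0 s0; have /admissibleP[_ adm'] := adm.
rewrite costB// ?lerDr//; rewrite -[X in `[X, _]](add0r h).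
rewrite -Rintegral_shift; last first.
  by apply: running_cost_integrable adm' _ _; rewrite ?add0r ?lerDr.
apply: eq_Rintegral => r; rewrite inE/= in_itv/= => /andP[r0 _].
exact: running_cost_shift.
Qed.

(** Curves that part at [t] may have different right speeds at [t], but this single point does not
    affect the integral; so agreement before [t] suffices, as concatenations need. *)
Lemma cost_eq xi zeta (t : R) : admissible H xi -> admissible H zeta -> 0 <= t ->
  {in `[0, t[, xi =1 zeta} -> cost xi t = cost zeta t.
Proof.
move=> /admissibleP[_ ax] /admissibleP[_ az] t0 E; rewrite /cost.
have I eta : admissible_after H eta 0 ->
    mu.-integrable `[0, t[ (EFin \o running_cost eta).
  move=> ae; apply: integrableS (running_cost_integrable ae (lexx 0) t0) => //.
  exact: subset_itv_co_cc.
rewrite -!Rintegral_itv_bndo_bndc; [|exact: I|exact: I].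
apply: eq_Rintegral => r; rewrite inE/= in_itv/= => /andP[r0 rt].
apply: (@running_cost_eq _ _ _ (t - r)) => //; first by rewrite subr_gt0.
move=> x; rewrite in_itv/= addrC subrK => /andP[rx xt]; apply: E.
by rewrite in_itv/= xt (le_trans r0).
Qed.

Lemma cost_concat xi (h : R) zeta (s : R) : admissible H (concat xi h zeta) ->
  admissible H zeta -> zeta 0 = xi h -> 0 <= h -> 0 <= s ->
  cost (concat xi h zeta) (s + h) = cost (concat xi h zeta) h + cost zeta s.
Proof.
move=> ac az E h0 s0; have := cost_shift ac h0 s0.
rewrite (@cost_eq _ zeta)//; [lra|exact: admissible_shift|].
by move=> r; rewrite in_itv/= => /andP[r0 _]; exact: concat_right.
Qed.

(** On a piece of speed [v] the distance is at most [v * (r - l)], so integrating [K * v - C] pays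
    for it; the triangle inequality joins the pieces. [K = 0] yields finiteness of the value,
    positive [K] its modulus in time. *)
Lemma cost_lower_bound xi (K C s t : R) : admissible H xi -> 0 <= K ->
  (forall x v, 0 <= v -> ((K * v - C)%:E <= lagrangian H x v)%E) ->
  0 <= s -> s <= t -> K * mdist (xi s) (xi t) - C * (t - s) <= cost xi t - cost xi s.
Proof.
move=> /admissibleP[ac adm] K0 KL s0 st.
pose P l r := 0 <= l -> K * mdist (xi l) (xi r) - C * (r - l) <= cost xi r - cost xi l.
suff : P s t by apply.
apply: (@admissible_pieces_ind xi P _ _ 0) => //.
- move=> l m r lm mr Plm Pmr l0; have := Plm l0; have := Pmr (le_trans l0 lm).
  by have := ler_wpM2l K0 (metric_triangle (xi l) (xi m) (xi r)); lra.
- move=> l r; rewrite le_eqVlt => /predU1P[->|lr] [v [v0 sv fv cv]] l0.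
    by rewrite mdistxx !subrr !mulr0 subrr.
  have d : mdist (xi l) (xi r) <= v * (r - l).
    apply: (ae_speed_dist (ltW lr) v0 ac).
      by move=> x /=; rewrite !in_itv/= andbT => /andP[/(le_trans l0)].
    by apply: ae_speedS sv; exact: subset_itv_oo_cc.
  rewrite costB ?(ltW lr)//.
  apply: (@le_trans _ _ ((K * v - C) * (r - l))).
    by have := ler_wpM2l K0 d; lra.
  have io : mu.-integrable `[l, r[ (EFin \o running_cost xi).
    apply: integrableS (running_cost_integrable adm l0 (ltW lr)) => //.
    exact: subset_itv_co_cc.
  rewrite -Rintegral_itv_bndo_bndc//.
  have -> : (K * v - C) * (r - l) = \int[mu]_(x in `[l, r[) (K * v - C).
    by rewrite Rintegral_cst_itv// ltW.
  apply: le_Rintegral => //; first exact: integrable_cst_itv.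
  move=> x /=; rewrite in_itv/= => xlr; rewrite (running_cost_piece sv)//.
  have fx : lagrangian H (xi x) v \is a fin_num.
    by apply: fv; rewrite /= in_itv/=; lra.
  by rewrite -lee_fin fineK// KL.
Qed.

Lemma cost_constant_speed_le xi (c C tau : R) : admissible_after H xi 0 -> 0 <= tau ->
  ae_speed xi `]0, tau[ c -> (forall x, lagrangian H x c \is a fin_num) ->
  (forall x, (lagrangian H x c <= C%:E)%E) -> cost xi tau <= C * tau.
Proof.
move=> adm; rewrite le_eqVlt => /predU1P[<-|t0] sc fc LC; first by rewrite cost0 mulr0.
have io : mu.-integrable `[0, tau[ (EFin \o running_cost xi).
  apply: integrableS (running_cost_integrable adm (lexx 0) (ltW t0)) => //.
  exact: subset_itv_co_cc.
rewrite /cost -Rintegral_itv_bndo_bndc//.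
have -> : C * tau = \int[mu]_(x in `[0, tau[) C.
  by rewrite Rintegral_cst_itv ?subr0// ltW.
apply: le_Rintegral => //; first exact: integrable_cst_itv.
move=> x /=; rewrite in_itv/= => /andP[x0 xt]; rewrite /running_cost.
rewrite (@right_speedE _ _ _ _ (tau - x) c) ?subr_gt0//.
  by rewrite -lee_fin fineK.
apply: ae_speedS sc => y /=; rewrite !in_itv/= addrC subrK => /andP[xy ->].
by rewrite (le_lt_trans x0).
Qed.

End cost.

(** * One-sided differentials *)

Section right_derivatives.
Variable R : realType.

Lemma is_derive_right (f : R -> R) (h p : R) :
  is_derive h 1 f p -> has_right_derivative f h p.
Proof.
move=> [df fp].
have : e^-1 *: (f (e *: (1 : R) + h) - f h) @[e --> 0^'] --> p by rewrite -fp; exact: df.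
move=> /cvgrPdist_lt D; apply/cvgrPdist_lt => e e0.
have [d /= d0 dP] := D e e0; exists d => //= s sd hs.
have := dP (s - h); rewrite /= sub0r normrN distrC => /(_ sd).
rewrite subr_eq0 gt_eqF// => /(_ isT).
by rewrite /GRing.scale/= mulr1 subrK mulrC.
Qed.

Lemma has_right_derivative_le (f g : R -> R) (h r p q : R) : 0 < r ->
  has_right_derivative f h p -> has_right_derivative g h q ->
  (forall s, h <= s < h + r -> f s - f h <= g s - g h) -> p <= q.
Proof.
move=> r0 fp gq fg; apply: (ler_cvg_to fp gq).
near=> s.
have hs : h < s by near: s; exact: nbhs_right_gt.
rewrite ler_pM2r ?invr_gt0 ?subr_gt0//; apply: fg; rewrite (ltW hs)/=.
by near: s; apply: nbhs_right_lt; rewrite ltrDl.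
Unshelve. all: by end_near. Qed.

Lemma piecewise_C1_primitive (F k : R -> R) (h r sigma : R) : 0 < r ->
  continuous k -> (forall x, h - 1 < x -> is_derive x 1 F (k x)) ->
  let phi := fun s => sigma * s - F s in
  piecewise_C1 h (h + r) phi /\ has_right_derivative phi h (sigma - k h).
Proof.
move=> r0 ck Fk phi.
have dphi x : h - 1 < x -> is_derive x 1 phi (sigma - k x).
  move=> /Fk Fx; have -> : sigma - k x = sigma *: 1 - k x by rewrite /GRing.scale/= mulr1.
  exact: is_deriveB.
have cphi : {within `[h, h + r[, continuous phi}.
  apply: derivable_within_continuous => x; rewrite in_itv/= => /andP[hx _].
  have hx1 : h - 1 < x by rewrite (lt_le_trans _ hx)// ltrBlDr ltrDl.
  by have [] := dphi x hx1.
split; last by apply/is_derive_right/dphi; rewrite ltrBlDr ltrDl.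
split => //; exists [::]; split => // J; rewrite inE => /eqP ->; split => //.
exists (fun x => sigma - k x).
  apply: continuous_subspaceT => x; apply: cvgB; first exact: cvg_cst.
  exact: ck.
move=> s; rewrite interior_itv_bnd/= in_itv/= => /andP[hs _]; apply: dphi.
by rewrite (lt_trans _ hs)// ltrBlDr ltrDl.
Qed.

End right_derivatives.

Section one_sided_differentials.
Variables (R : realType) (X : metricType R) (H : X -> R -> R) (xi : R -> X) (t : R).
Hypothesis adm : admissible_after H xi 0.
Implicit Types (w : R -> R).

Let E h := lagrangian H (xi h) (right_speed xi h).
Let c := cost H xi.

Let itvS (h r : R) : 0 <= h -> h + r <= t -> `[h, h + r[ `<=` (`[0, t[ : set R).
Proof.
move=> h0 hrt x /=; rewrite !in_itv/= => /andP[hx xr].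
by rewrite (le_trans h0) ?(lt_le_trans xr).
Qed.

Let cost_continuousS (b : R) : 0 <= b -> {within `[0, b], continuous c}.
Proof. exact: cost_continuous. Qed.

Let withinS w (b : R) : b < t -> {within `[0, t[, continuous w} -> {within `[0, b], continuous w}.
Proof.
move=> bt; apply: continuous_subspaceW => x /=; rewrite !in_itv/= => /andP[->] /=.
by move=> /le_lt_trans; apply.
Qed.

Lemma superdifferential_cost_increasing w :
  {within `[0, t[, continuous w} ->
  (forall h, 0 <= h < t -> forall p, right_superdifferential `[0, t[ w h p ->
    ((- p)%:E <= E h)%E) ->
  forall b, 0 <= b < t -> w 0 <= w b + c b.
Proof.
move=> cw sup b /andP[]; rewrite le_eqVlt => /predU1P[<-|b0] bt.
  by rewrite /c cost0 addr0.
rewrite leNgt; apply/negP => wb.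
(* Half the mean slope of the violation: [z] is still smaller at [b] than at [0], so its maximum is
   at some [h < b], with room to the right. *)
pose sg := (w 0 - (w b + c b)) / (2 * b).
have sg0 : 0 < sg by rewrite divr_gt0 ?mulr_gt0// subr_gt0.
have sgb : sg * b = (w 0 - (w b + c b)) / 2.
  by rewrite /sg invfM mulrA -(mulrA _ b^-1) mulVf ?mulr1// gt_eqF.
pose z s := w s + c s + sg * s.
have cz : {within `[0, b], continuous z}.
  apply: within_continuousD; first apply: within_continuousD.
  - exact: withinS.
  - exact/cost_continuousS/ltW.
  - apply: continuous_subspaceT => x; apply: cvgMr; exact: cvg_id.
have [h hb zh] := EVT_max (ltW b0) cz.
move: hb; rewrite in_itv/= => /andP[h0 hb].
have hltb : h < b.
  rewrite lt_neqAle hb andbT; apply/eqP => hb'.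
  have := zh 0; rewrite in_itv/= lexx (ltW b0) => /(_ isT).
  by rewrite hb' /z /c cost0 !addr0 mulr0 addr0 -/c sgb; lra.
have [e [F [k [e0 ck kh Lh [Fk cF]]]]] := cost_right_primitive adm h0.
have r0 : 0 < Num.min e (b - h) by rewrite lt_min e0 subr_gt0.
set r := Num.min e (b - h) in r0.
have re : r <= e by rewrite ge_min lexx.
have rb : h + r <= b by rewrite addrC -lerBrDr ge_min lexx orbT.
(* The test function has slope [- sg - k h], for which the hypothesis reads [sg + k h <= k h], a
   contradiction. *)
have [pw dphi] := piecewise_C1_primitive (- sg) r0 ck Fk.
have := sup h _ (- sg - k h) _; rewrite h0 (lt_trans hltb)// /E Lh lee_fin -kh.
suff D : right_superdifferential `[0, t[ w h (- sg - k h) by move=> /(_ isT D); lra.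
exists r, (fun s => - sg * s - F s); split => //.
  by apply: itvS => //; exact: le_trans (ltW bt).
move=> s /andP[hs sr].
have := zh s; rewrite in_itv/= (le_trans h0 hs) (ltW (lt_le_trans sr rb)) => /(_ isT).
have := cF s; rewrite hs (lt_le_trans sr) ?lerD2l// => /(_ isT).
by rewrite /z /c; lra.
Qed.

Lemma subdifferential_cost_decreasing w :
  {within `[0, t[, continuous w} ->
  (forall h, 0 <= h < t -> forall p, right_subdifferential `[0, t[ w h p ->
    ((- p)%:E >= E h)%E) ->
  forall b, 0 <= b < t -> w b + c b <= w 0.
Proof.
move=> cw sub b /andP[]; rewrite le_eqVlt => /predU1P[<-|b0] bt.
  by rewrite /c cost0 addr0.
rewrite leNgt; apply/negP => wb.
pose sg := ((w b + c b) - w 0) / (2 * b).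
have sg0 : 0 < sg by rewrite divr_gt0 ?mulr_gt0// subr_gt0.
have sgb : sg * b = ((w b + c b) - w 0) / 2.
  by rewrite /sg invfM mulrA -(mulrA _ b^-1) mulVf ?mulr1// gt_eqF.
pose z s := w s + c s + (- sg) * s.
have cz : {within `[0, b], continuous z}.
  apply: within_continuousD; first apply: within_continuousD.
  - exact: withinS.
  - exact/cost_continuousS/ltW.
  - apply: continuous_subspaceT => x; apply: cvgMr; exact: cvg_id.
have [h hb zh] := EVT_min (ltW b0) cz.
move: hb; rewrite in_itv/= => /andP[h0 hb].
have hltb : h < b.
  rewrite lt_neqAle hb andbT; apply/eqP => hb'.
  have := zh 0; rewrite in_itv/= lexx (ltW b0) => /(_ isT).
  by rewrite hb' /z /c cost0 !addr0 mulr0 addr0 -/c mulNr sgb; lra.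
have [e [F [k [e0 ck kh Lh [Fk cF]]]]] := cost_right_primitive adm h0.
have r0 : 0 < Num.min e (b - h) by rewrite lt_min e0 subr_gt0.
set r := Num.min e (b - h) in r0.
have re : r <= e by rewrite ge_min lexx.
have rb : h + r <= b by rewrite addrC -lerBrDr ge_min lexx orbT.
have [pw dphi] := piecewise_C1_primitive sg r0 ck Fk.
have := sub h _ (sg - k h) _; rewrite h0 (lt_trans hltb)// /E Lh lee_fin -kh.
suff D : right_subdifferential `[0, t[ w h (sg - k h) by move=> /(_ isT D); lra.
exists r, (fun s => sg * s - F s); split => //.
  by apply: itvS => //; exact: le_trans (ltW bt).
move=> s /andP[hs sr].
have := zh s; rewrite in_itv/= (le_trans h0 hs) (ltW (lt_le_trans sr rb)) => /(_ isT).
have := cF s; rewrite hs (lt_le_trans sr) ?lerD2l// => /(_ isT).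
by rewrite /z /c; lra.
Qed.

(** To the right of [h] a test function grows at least as much as [w], and [w] falls no faster than
    the cost rises; comparing right derivatives gives the claim. *)
Lemma cost_increasing_superdifferential w (h p : R) : 0 <= h < t ->
  (forall s, h <= s < t -> w h <= w s + (c s - c h)) ->
  right_superdifferential `[0, t[ w h p -> ((- p)%:E <= E h)%E.
Proof.
move=> /andP[h0 ht] wc [r [phi [r0 rt pw dphi wphi]]].
have [e [F [k [e0 ck kh Lh [Fk cF]]]]] := cost_right_primitive adm h0.
have [_ dF] := piecewise_C1_primitive 0 e0 ck Fk.
rewrite /E Lh lee_fin -kh lerNl -(sub0r (k h)).
apply: (@has_right_derivative_le _ _ _ h (Num.min r e) _ _ _ dF dphi).
  by rewrite lt_min r0.
move=> s /andP[hs]; rewrite -ltrBlDl lt_min !ltrBlDl => /andP[sr se].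
have /= := rt s; rewrite !in_itv/= hs sr => /(_ isT)/andP[_ st].
have := wc s; rewrite hs st => /(_ isT).
have := wphi s; rewrite hs sr => /(_ isT).
by have := cF s; rewrite hs se => /(_ isT); rewrite /c; lra.
Qed.

Lemma cost_decreasing_subdifferential w (h p : R) : 0 <= h < t ->
  (forall s, h <= s < t -> w s + (c s - c h) <= w h) ->
  right_subdifferential `[0, t[ w h p -> ((- p)%:E >= E h)%E.
Proof.
move=> /andP[h0 ht] wc [r [phi [r0 rt pw dphi wphi]]].
have [e [F [k [e0 ck kh Lh [Fk cF]]]]] := cost_right_primitive adm h0.
have [_ dF] := piecewise_C1_primitive 0 e0 ck Fk.
rewrite /E Lh lee_fin -kh lerNr -(sub0r (k h)).
apply: (@has_right_derivative_le _ _ _ h (Num.min r e) _ _ _ dphi dF).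
  by rewrite lt_min r0.
move=> s /andP[hs]; rewrite -ltrBlDl lt_min !ltrBlDl => /andP[sr se].
have /= := rt s; rewrite !in_itv/= hs sr => /(_ isT)/andP[_ st].
have := wc s; rewrite hs st => /(_ isT).
have := wphi s; rewrite hs sr => /(_ isT).
by have := cF s; rewrite hs se => /(_ isT); rewrite /c; lra.
Qed.

End one_sided_differentials.

(** * The value function *)

Section value_function.
Variables (R : realType) (X : metricType R) (H : X -> R -> R) (u0 : X -> R).
Implicit Types (xi zeta g : R -> X).

Hypothesis L_superlinear : forall K, 0 <= K -> exists C, forall x v, 0 <= v ->
  ((K * v - C)%:E <= lagrangian H x v)%E.
Hypothesis L_continuous :
  {within lagrangian_dom H, continuous (fun z => lagrangian H z.1 z.2)}.
Variables (c0 C0 : R).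
Hypothesis c0_gt0 : 0 < c0.
Hypothesis L_bounded : forall x v, 0 <= v <= c0 -> (lagrangian H x v <= C0%:E)%E.
Hypothesis u0_bounded : exists M, forall x, `|u0 x| <= M.
Hypothesis u0_unif_continuous : forall e, 0 < e ->
  exists2 d, 0 < d & forall x y, mdist x y < d -> `|u0 x - u0 y| < e.

Lemma lagrangian_fin_num x v : 0 <= v <= c0 -> lagrangian H x v \is a fin_num.
Proof.
move=> /[dup] /andP[v0 _] vc; have [C HC] := L_superlinear (lexx 0).
rewrite fin_numElt (le_lt_trans (L_bounded x vc) (ltry _)) andbT.
by apply: lt_le_trans (HC x v v0); exact: ltNyr.
Qed.

(** The Lagrangian is continuous only on its domain; at speeds up to [c0] the pair of position and
    speed never leaves it, wherever the curve goes. *)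
Lemma constant_speed_piece g (I : set R) v : 0 <= v <= c0 -> continuous g ->
  ae_speed g I v -> admissible_piece H I g.
Proof.
move=> vc cg sv; have /andP[v0 _] := vc; exists v; split => //.
  by move=> r _; exact: lagrangian_fin_num.
apply: continuous_subspaceT => r.
have dom x : lagrangian_dom H (x, v).
  by split => //=; apply: le_lt_trans (L_bounded x vc) (ltry _).
have := (subspace_continuousP _ _).1 L_continuous (g r, v) (dom _).
apply: (@cvg_comp _ _ _ (fun s => (g s, v)) (fun z => lagrangian H z.1 z.2)).
move=> A; rewrite /within/= => hA.
have gv : (g s, v) @[s --> r] --> (g r, v) by exact: (cvg_pair (cg r) (cvg_cst v)).
have : \forall s \near r, lagrangian_dom H (g s, v) -> A (g s, v) by exact: gv hA.
by apply: filterS => s; apply; exact: dom.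
Qed.

Lemma lipschitz_continuous g v : 0 <= v ->
  (forall s t, mdist (g s) (g t) <= v * `|s - t|) -> continuous g.
Proof. by move=> v0 lip; apply/abs_continuous_continuous/(lipschitz_abs_continuous v0 lip). Qed.

Lemma admissible_cst x : admissible_from H x (fun=> x).
Proof.
split => //; apply/admissibleP; split.
  by apply: (@lipschitz_abs_continuous _ _ _ _ 0) => // s t; rewrite mdistxx mul0r.
apply: admissible_last; apply: (@constant_speed_piece _ _ 0).
- by rewrite lexx ltW.
- by move=> r; exact: cvg_cst.
- exact: ae_speed_cst.
Qed.

Definition value (x : X) (t : R) : R := fine (value_function H u0 x t).

Lemma value_functionE x t : 0 <= t -> value_function H u0 x t =
  ereal_inf [set (cost H xi t + u0 (xi t))%:E | xi in admissible_from H x].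
Proof.
move=> t0; rewrite /value_function; congr ereal_inf; apply/seteqP.
split=> _ [xi [adm xi0] <-]; exists xi => //;
  by have /admissibleP[_ a] := adm; rewrite cost_integralE.
Qed.

Lemma value_function_fin_num x t : 0 <= t -> value_function H u0 x t \is a fin_num.
Proof.
move=> t0; have [C HC] := L_superlinear (lexx 0); have [M HM] := u0_bounded.
rewrite value_functionE// fin_numElt; apply/andP; split; last first.
  apply: le_lt_trans (ltry (cost H (fun=> x) t + u0 x)); apply: ereal_inf_lbound.
  by exists (fun=> x) => //; exact: admissible_cst.
apply: (@lt_le_trans _ _ ((- C * t - M)%:E)); first exact: ltNyr.
apply: le_ereal_inf_tmp => _ [xi [adm _] <-]; rewrite lee_fin.
have := cost_lower_bound adm (lexx 0) HC (lexx 0) t0; rewrite mul0r cost0.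
by have := HM (xi t); rewrite ler_norml => /andP[]; lra.
Qed.

Lemma value_le xi t : admissible H xi -> 0 <= t ->
  value (xi 0) t <= cost H xi t + u0 (xi t).
Proof.
move=> adm t0; rewrite -lee_fin fineK ?value_function_fin_num//.
by rewrite value_functionE//; apply: ereal_inf_lbound; exists xi.
Qed.

Lemma value_adherent x t e : 0 <= t -> 0 < e ->
  exists2 xi, admissible_from H x xi & cost H xi t + u0 (xi t) < value x t + e.
Proof.
move=> t0 e0; have fv := value_function_fin_num x t0.
rewrite value_functionE// in fv.
have [_ [xi ax <-]] := lb_ereal_inf_adherent e0 fv.
rewrite -value_functionE// -[value_function _ _ _ _]fineK ?value_function_fin_num//.
by rewrite -EFinD lte_fin => ?; exists xi.
Qed.

Lemma value0 x : value x 0 = u0 x.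
Proof.
apply/eqP; rewrite eq_le; apply/andP; split.
  have [a a0] := admissible_cst x.
  by have := value_le a (lexx 0); rewrite cost0 add0r.
apply/ler_addgt0Pr => e e0.
have [xi [_ xi0]] := value_adherent x (lexx 0) e0.
by rewrite cost0 add0r xi0 => /ltW.
Qed.

Lemma abs_continuous_admissible xi (h : R) : admissible H xi -> abs_continuous `[0, h] xi.
Proof.
move=> /admissibleP[ac _]; apply: abs_continuousS ac => r /=.
by rewrite !in_itv/= => /andP[->].
Qed.

(** Following [xi] up to [h] and then a near-minimizer from [xi h] is a competitor for the value at
    [xi 0]. *)
Lemma value_dpp xi h t : admissible H xi -> 0 <= h -> h <= t ->
  value (xi 0) t <= cost H xi h + value (xi h) (t - h).
Proof.
move=> adm h0 ht; apply/ler_addgt0Pr => e e0.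
have th0 : 0 <= t - h by rewrite subr_ge0.
have [zeta [az z0] zv] := value_adherent (xi h) th0 e0.
have ac : admissible H (concat xi h zeta).
  apply: admissible_concat => //; first exact: abs_continuous_admissible.
  by right; have /admissibleP[] := adm.
have c0E : concat xi h zeta 0 = xi 0 by rewrite /concat h0.
have := value_le ac (le_trans h0 ht); rewrite c0E -{2 3}(subrK h t).
rewrite concat_right// cost_concat// (@cost_eq _ _ _ _ xi)//; first by lra.
by move=> r; rewrite in_itv/= /concat => /andP[_ /ltW ->].
Qed.

(** The tail of [xi] competes from [xi h]. For a near-minimizer this bounds the value along the
    curve by the initial value minus the cost so far, up to the same error at all [h]. *)
Lemma value_shift xi h t : admissible H xi -> 0 <= h -> h <= t ->
  value (xi h) (t - h) <= cost H xi t - cost H xi h + u0 (xi t).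
Proof.
move=> adm h0 ht; have th0 : 0 <= t - h by rewrite subr_ge0.
have := value_le (admissible_shift h0 adm) th0; rewrite add0r.
by rewrite cost_shift// subrK.
Qed.

Lemma value_dpp_shift xi h s t : admissible H xi -> 0 <= h -> h <= s -> s <= t ->
  value (xi h) (t - h) <= value (xi s) (t - s) + (cost H xi s - cost H xi h).
Proof.
move=> adm h0 hs st.
have sh0 : 0 <= s - h by rewrite subr_ge0.
have := @value_dpp _ (s - h) (t - h) (admissible_shift h0 adm) sh0.
rewrite lerD2r => /(_ st); rewrite add0r cost_shift// subrK.
have -> : t - h - (s - h) = t - s by lra.
lra.
Qed.

(** Used with [v = 0], where waiting costs at most [C0] per unit of time, and with [v = c0] for arc
    length curves. *)
Lemma value_reach g (v tau t : R) : 0 <= v <= c0 -> 0 <= tau -> 0 <= t ->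
  (forall x y, mdist (g x) (g y) <= v * `|x - y|) -> ae_speed g `]0, tau[ v ->
  value (g 0) (t + tau) <= C0 * tau + value (g tau) t.
Proof.
move=> vc tau0 t0 lip sv; have /andP[v0 _] := vc.
apply/ler_addgt0Pr => e e0.
have [zeta [az z0] zv] := value_adherent (g tau) t0 e0.
have sv' : ae_speed g `[0, tau] v.
  apply: (@ae_speedS _ _ _ (`]0, tau[ `|` ([set 0] `|` [set tau]))).
    move=> x /=; rewrite in_itv/= => /andP[x0 xt].
    have [->|xn0] := eqVneq x 0; first by right; left.
    have [->|xnt] := eqVneq x tau; first by right; right.
    by left; rewrite /= in_itv/= !lt_neqAle eq_sym xn0 x0 xnt xt.
  by do 2 (apply: ae_speedU => //); apply: ae_speed_negligible; exact: negligible_pt.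
have ac : admissible H (concat g tau zeta).
  apply: admissible_concat => //; first exact: (lipschitz_abs_continuous v0 lip).
  by left; apply: (constant_speed_piece vc _ sv'); exact: lipschitz_continuous lip.
have c0E : concat g tau zeta 0 = g 0 by rewrite /concat tau0.
have := value_le ac (addr_ge0 t0 tau0); rewrite c0E concat_right// cost_concat//.
have /admissibleP[_ aft] := ac.
have : cost H (concat g tau zeta) tau <= C0 * tau.
  apply: (cost_constant_speed_le aft tau0 (c := v)).
  - apply: ae_speed_eq sv; first exact: interval_open.
    by move=> r; rewrite inE/= in_itv/= /concat => /andP[_ /ltW ->].
  - by move=> x; exact: lagrangian_fin_num.
  - by move=> x; exact: L_bounded.
by lra.
Qed.

Lemma value_time_modulus e : 0 < e -> exists2 d, 0 < d &
  forall x s t, 0 <= s -> 0 <= t -> `|s - t| < d -> `|value x s - value x t| <= e.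
Proof.
move=> e0; have e3 : 0 < e / 3 by rewrite divr_gt0.
have [M HM] := u0_bounded.
have [d d0 Hd] := u0_unif_continuous e3.
have M0 : 0 <= `|M| by [].
(* At distances of at least [d], the oscillation of [u0], at most [2 * |M|], is below [K] times the
   distance. *)
pose K := 2 * `|M| / d.
have K0 : 0 <= K by rewrite divr_ge0 ?(ltW d0)// mulr_ge0.
have u0K y z : `|u0 y - u0 z| <= e / 3 + K * mdist y z.
  have [yz|yz] := ltP (mdist y z) d.
    by apply: (le_trans (ltW (Hd _ _ yz))); rewrite lerDl mulr_ge0// mdist_ge0.
  have : K * d <= K * mdist y z by exact: ler_wpM2l.
  have -> : K * d = 2 * `|M| by rewrite /K divfK// gt_eqF.
  have := HM y; have := HM z; have := ler_norm M; have := ler_normB (u0 y) (u0 z); lra.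
have [C HC] := L_superlinear K0.
(* [D] dominates [C] and [C0], so [h < e / (3 * D)] keeps both [C * h] and [C0 * h] within [e / 3];
   the summand [1] makes it positive. *)
pose D := `|C| + `|C0| + 1.
have D0 : 0 < D by rewrite /D; have := normr_ge0 C; have := normr_ge0 C0; lra.
exists (e / (3 * D)); first by rewrite divr_gt0// mulr_gt0.
suff H1 x t h : 0 <= t -> 0 <= h -> h < e / (3 * D) ->
    `|value x t - value x (t + h)| <= e.
  move=> x s t s0 t0 st; have [s_t|t_s] := leP s t.
    have E : t = s + (t - s) by lra.
    rewrite E H1 ?subr_ge0//; move: st; rewrite ler0_norm ?subr_le0//; lra.
  have E : s = t + (s - t) by lra.
  rewrite gtr0_norm ?subr_gt0// in st.
  by rewrite distrC E H1 ?subr_ge0 ?(ltW t_s).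
move=> t0 h0 hd.
have hD : h * D <= e / 3.
  by move: hd; rewrite invfM mulrA ltr_pdivlMr// => /ltW.
have Ch : C * h <= e / 3.
  apply: le_trans hD; rewrite mulrC ler_wpM2l// /D.
  by have := ler_norm C; have := normr_ge0 C0; lra.
have C0h : C0 * h <= e / 3.
  apply: le_trans hD; rewrite mulrC ler_wpM2l// /D.
  by have := ler_norm C0; have := normr_ge0 C; lra.
rewrite ler_norml; apply/andP; split.
  have := @value_reach (fun=> x) 0 h t _ h0 t0 _ _.
  rewrite lexx ltW// => /(_ isT) V.
  have {}V : value x (t + h) <= C0 * h + value x t.
    by apply: V; [move=> y z; rewrite mdistxx mul0r|exact: ae_speed_cst].
  by lra.
have th0 : 0 <= t + h by exact: addr_ge0.
have tth : t <= t + h by rewrite lerDl.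
(* A near-minimizer for [t + h] is stopped at [t]: [u0] changes by at most
   [e / 3 + K * mdist (xi t) (xi (t + h))], and the omitted cost is at least the same distance term
   minus [C * h], so the distance cancels. *)
have [xi [axi xi0] xv] := value_adherent x th0 e3.
have := value_le axi t0; rewrite xi0.
have := cost_lower_bound axi K0 HC t0 tth; rewrite addrAC subrr add0r.
have := u0K (xi t) (xi (t + h)); rewrite ler_norml => /andP[_].
lra.
Qed.

(** Near [s0] arcs have length at most [f * c0], which takes time at most [f] at speed [c0]. *)
Lemma short_curve xi s0 f : abs_continuous setT xi -> 0 < f ->
  exists2 d, 0 < d & forall s s', s0 - d < s -> s <= s' -> s' < s0 + d ->
  exists (tau : R) (g : R -> X), [/\ 0 <= tau <= f,
    forall x y, mdist (g x) (g y) <= c0 * `|x - y|, g 0 = xi s, g tau = xi s' &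
    ae_speed g `]0, tau[ c0].
Proof.
move=> ac f0.
have [||d d0 Hd] := @abs_continuous_polygonal _ _ xi (s0 - 1) (s0 + 1) (f * c0) _ ac.
- lra.
- exact: mulr_gt0.
exists (Num.min (d / 2) 1); first by rewrite lt_min divr_gt0//= ltr01.
move=> s s'; rewrite ltrBlDr -ltrBlDl lt_min => + ss'.
rewrite -[s' < _]ltrBlDl lt_min => /andP[h1 h2] /andP[h3 h4].
have [|tau [g]] := @constant_speed_curve _ _ xi s s' c0 (f * c0) c0_gt0 ss' ac.
  move=> p sp lp; apply/ltW/Hd => //; rewrite ?lp; lra.
rewrite mulfK ?gt_eqF// => Hg; exists tau, g; exact: Hg.
Qed.

Lemma value_arcwise_continuous xi s0 t0 e : abs_continuous setT xi -> 0 <= t0 -> 0 < e ->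
  exists2 d, 0 < d & forall s t, 0 <= t -> `|s0 - s| < d -> `|t0 - t| < d ->
    `|value (xi s0) t0 - value (xi s) t| < e.
Proof.
move=> ac t00 e0; have e4 : 0 < e / 4 by rewrite divr_gt0.
have [d d0 Hd] := value_time_modulus e4.
(* The first bound keeps the time shift [tau] within the modulus [d], at the price [e / 4]; the
   second bounds the cost [C0 * tau] by [e / 4]. Passing from [t0] to [t] takes another [e / 4]. *)
pose f := Num.min (d / 2) (e / 4 / (`|C0| + 1)).
have C01 : 0 < `|C0| + 1 by have := normr_ge0 C0; lra.
have f0 : 0 < f by rewrite lt_min !divr_gt0.
have [d1 d10 H1] := short_curve s0 ac f0.
(* [short_curve] only runs forward; the reversed curve supplies the opposite inequality. *)
have [d2 d20 H2] := short_curve (- s0) (abs_continuous_reverse ac) f0.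
have key tau g t : 0 <= t -> 0 <= tau <= f ->
    (forall x y, mdist (g x) (g y) <= c0 * `|x - y|) -> ae_speed g `]0, tau[ c0 ->
    value (g 0) t <= e / 2 + value (g tau) t.
  move=> tp /andP[tau0]; rewrite le_min => /andP[td te] lip sp.
  have := value_reach (v := c0) _ tau0 tp lip sp.
  rewrite (ltW c0_gt0) lexx => /(_ isT).
  have := Hd (g 0) t (t + tau) tp (addr_ge0 tp tau0).
  rewrite opprD addrA subrr sub0r normrN ger0_norm// => /(_ ltac:(lra)).
  rewrite ler_norml => /andP[_].
  move: te; rewrite ler_pdivlMr// => te.
  have : C0 * tau <= tau * (`|C0| + 1).
    by rewrite mulrC ler_wpM2l//; have := ler_norm C0; lra.
  lra.
exists (Num.min d (Num.min d1 d2)); first by rewrite !lt_min d0 d10.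
move=> s t tp; rewrite !lt_min => /and3P[_ s1 s2] /andP[td _].
have := Hd (xi s0) t0 t t00 tp td; rewrite ler_norml => /andP[a1 a2].
have [b1 b2] : value (xi s0) t <= e / 2 + value (xi s) t /\
    value (xi s) t <= e / 2 + value (xi s0) t.
  move: s1 s2; rewrite !ltr_norml => /andP[s1 s1'] /andP[s2 s2'].
  have [ss|ss] := leP s0 s.
    have [tau [g [tf lip g0 gt sp]]] := H1 s0 s ltac:(lra) ss ltac:(lra).
    have [tau' [g' [tf' lip' g0' gt' sp']]] := H2 (- s) (- s0) ltac:(lra) ltac:(lra) ltac:(lra).
    have := key _ _ _ tp tf lip sp; have := key _ _ _ tp tf' lip' sp'.
    by rewrite g0 gt g0' gt' !opprK.
  have [tau [g [tf lip g0 gt sp]]] := H1 s s0 ltac:(lra) (ltW ss) ltac:(lra).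
  have [tau' [g' [tf' lip' g0' gt' sp']]] := H2 (- s0) (- s) ltac:(lra) ltac:(lra) ltac:(lra).
  have := key _ _ _ tp tf lip sp; have := key _ _ _ tp tf' lip' sp'.
  by rewrite g0 gt g0' gt' !opprK.
by rewrite ltr_norml; lra.
Qed.

End value_function.

(** * Arcwise continuous functions along admissible curves *)

Section arcwise.
Variables (R : realType) (X : metricType R) (H : X -> R -> R).

Lemma arcwise_continuous_along (u : X -> R -> R) (J A : set R) (xi : R -> X) (t : R) :
  arcwise_continuous J u -> admissible H xi ->
  (forall h, A h -> 0 <= h /\ J (t - h)) ->
  {within A, continuous (fun h => u (xi h) (t - h))}.
Proof.
move=> cu /admissibleP[ac _] AJ.
have {}cu := (subspace_continuousP _ _).1 (cu _ (abs_continuous_extend ac)).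
apply/subspace_continuousP => h Ah; have [h0 Jh] := AJ h Ah.
move=> P PF.
have PF' : nbhs (u (xi (Num.max 0 h)) (t - h)) P by rewrite max_r.
have phi : (s, t - s) @[s --> h] --> (h, t - h).
  have c1 : s @[s --> h] --> h by exact: cvg_id.
  have c2 : (t - s) @[s --> h] --> t - h by apply: cvgB; [exact: cvg_cst|exact: cvg_id].
  exact: (cvg_pair c1 c2).
have : \forall s \near h, J (t - s) -> P (u (xi (Num.max 0 s)) (t - s)).
  exact: phi (cu (h, t - h) Jh P PF').
apply: filterS => s Ps As; have [s0 Js] := AJ s As.
by have := Ps Js; rewrite max_r.
Qed.

(** The differential inequalities are available on [[0, t[]; the initial datum sits at [h = t] and
    is reached by continuity. *)
Lemma le_within_endpoint (F : R -> R) (a t : R) : 0 < t ->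
  {within `[0, t], continuous F} -> (forall h, 0 <= h < t -> a <= F h) -> a <= F t.
Proof.
move=> t0 /(continuous_within_itvP _ t0) [_ _ Ft] aF.
apply: (ler_cvg_to (cvg_cst a) Ft); near=> s; apply: aF; apply/andP; split.
  by apply: ltW; near: s; exact: nbhs_left_gt.
by near: s; exact: nbhs_left_lt.
Unshelve. all: by end_near. Qed.

End arcwise.

Lemma arcwise_continuousS (R : realType) (X : metricType R) (I J : set R)
  (u : X -> R -> R) : I `<=` J -> arcwise_continuous J u -> arcwise_continuous I u.
Proof.
move=> IJ cu xi ac; apply: continuous_subspaceW (cu xi ac) => z /=.
exact: IJ.
Qed.

(** * Bounds on the Lagrangian from the assumptions on [H] *)

Section structural_bounds.
Variables (R : realType) (X : metricType R) (H : X -> R -> R).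

(** The single slope [p = K] in the supremum that defines [L] suffices, with [C] the supremum of
    [H x K] over [x]. *)
Lemma lagrangian_superlinear :
  (forall p : R, 0 <= p -> (ereal_sup (range (fun x => (H x p)%:E)) < +oo)%E) ->
  forall K, 0 <= K -> exists C, forall x v, 0 <= v ->
    ((K * v - C)%:E <= lagrangian H x v)%E.
Proof.
move=> Hsup K K0; have := Hsup K K0; set S := ereal_sup _ => Soo.
have HS x : ((H x K)%:E <= S)%E by apply: ereal_sup_ubound; exists x.
exists (fine S) => x v v0; apply: le_ereal_sup_tmp.
exists (K * v - H x K)%:E; first by exists K => //; rewrite /= in_itv/= K0.
rewrite lee_fin lerD2l lerN2 -lee_fin fineK// fin_numElt Soo andbT.
by apply: lt_le_trans (HS x); exact: ltNyr.
Qed.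

(** Growth yields [H x p >= c * p] for large [p], so for [v <= c] slopes beyond [P] contribute at
    most [0] to [L x v]; by monotonicity smaller ones contribute at most [c * P - H x 0]. *)
Lemma lagrangian_bounded :
  (forall x, {in `[0, +oo[ &, {homo H x : p q / p <= q}}) ->
  (-oo < ereal_inf (range (fun x => (H x 0)%:E)))%E ->
  (0 < limf_einf (fun p : R => ereal_inf (range (fun x => (H x p / p)%:E))) +oo%R)%E ->
  exists c C : R, 0 < c /\
    forall x v, 0 <= v <= c -> (lagrangian H x v <= C%:E)%E.
Proof.
move=> Hmon Hinf; rewrite limf_einfE => /ereal_sup_gt[_ [V Voo <-]] V0.
have [M [_ MV]] : \forall p \near +oo%R, V p by [].
have [c c0 cV] : exists2 c : R, 0 < c & (c%:E <= ereal_inf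
    [set ereal_inf (range (fun x => (H x p / p)%:E)) | p in V])%E.
  move: V0; case: (ereal_inf _) => [r| |]//.
  - by rewrite lte_fin => r0; exists r.
  - by move=> _; exists 1 => //; exact: leey.
have Hc x p : M < p -> 0 < p -> c * p <= H x p.
  move=> Mp p0; rewrite -ler_pdivlMr// -lee_fin; apply: (le_trans cV).
  apply: (@le_trans _ _ (ereal_inf (range (fun x => (H x p / p)%:E)))).
    by apply: ereal_inf_lbound; exists p => //; exact: MV.
  by apply: ereal_inf_lbound; exists x.
pose m := fine (ereal_inf (range (fun x => (H x 0)%:E))).
have Hm x : m <= H x 0.
  have Hx : (ereal_inf (range (fun x => (H x 0)%:E)) <= (H x 0)%:E)%E.
    by apply: ereal_inf_lbound; exists x.
  rewrite -lee_fin fineK// fin_numElt Hinf/=.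
  by apply: (le_lt_trans Hx); exact: ltry.
pose P := Num.max M 0.
exists c, (c * P + `|m|); split => // x v /andP[v0 vc].
apply: ge_ereal_sup => _ [p + <-]; rewrite /= in_itv/= andbT => p0; rewrite lee_fin.
have P0 : 0 <= P by rewrite le_max lexx orbT.
have pv : p * v <= c * p by rewrite mulrC ler_wpM2r.
have [pP|Pp] := leP p P.
  have : H x 0 <= H x p by apply: Hmon; rewrite ?in_itv/= ?lexx ?andbT.
  have := Hm x; have := ler_norm (- m); rewrite normrN.
  have : c * p <= c * P by apply: ler_wpM2l => //; exact: ltW.
  lra.
have [Mp p1] : M < p /\ 0 < p by move: Pp; rewrite gt_max => /andP.
have := Hc x p Mp p1; have := mulr_ge0 (ltW c0) P0; have := normr_ge0 m; lra.
Qed.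

End structural_bounds.

Theorem theorem4p2 (R : realType) (X : metricType R) (T : R)
    (H : X -> R -> R) (u0 : X -> R)
    (X_nonempty : [set: X] !=set0)
    (T_gt0 : 0 < T)
    (H_continuous :
      {within [set z : X * R | 0 <= z.2], continuous (fun z => H z.1 z.2)})
    (H_convex : forall x,
      convex_function (`[0, +oo[%classic : set R^o) (H x : R^o -> R^o))
    (H_nondecreasing : forall x,
      {in `[0, +oo[ &, {homo H x : p q / p <= q}})
    (H_sup : forall p : R, 0 <= p ->
      (ereal_sup (range (fun x => (H x p)%:E)) < +oo)%E)
    (H_inf0 : (-oo < ereal_inf (range (fun x => (H x 0)%:E)))%E)
    (H_growth :
      (0 < limf_einf (fun p : R => ereal_inf (range (fun x => (H x p / p)%:E)))
                     +oo%R)%E)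
    (L_continuous :
      {within lagrangian_dom H, continuous (fun z => lagrangian H z.1 z.2)})
    (L_dom_lsc : lower_semicontinuous
      (fun x : X => ereal_sup [set v%:E | v in [set v : R | lagrangian_dom H (x, v)]]))
    (u0_bounded : bounded_fun (u0 : X -> R^o))
    (u0_unif_continuous : unif_continuous (u0 : X -> R^o)) :
  let U := value_function H u0 in
  [/\ forall x t, 0 <= t < T -> U x t \is a fin_num,
      solution H T u0 (fun x t => fine (U x t)) &
      forall v : X -> R -> R, solution H T u0 v ->
        forall x t, 0 <= t < T -> v x t = fine (U x t)].
Proof.
move=> U.
have Lsup := lagrangian_superlinear H_sup.
have [c [C [c0 LC]]] := lagrangian_bounded H_nondecreasing H_inf0 H_growth.
have u0b : exists M, forall x, `|u0 x| <= M.
  have [M [_ HM]] := u0_bounded.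
  by exists (M + 1) => x; apply: HM; rewrite ?ltrDl.
have u0u e : 0 < e -> exists2 d, 0 < d & forall x y, mdist x y < d -> `|u0 x - u0 y| < e.
  move=> e0; have := u0_unif_continuous _ (@entourage_ball R R^o (PosNum e0)).
  rewrite /= -entourage_ballE => -[d /= d0 dP].
  exists d => // x y xyd.
  by apply: (dP (x, y)); rewrite /= ballEmdist.
pose u := value H u0.
have fU x t : 0 <= t -> U x t \is a fin_num.
  exact: (value_function_fin_num Lsup L_continuous c0 LC u0b).
have cu : arcwise_continuous `[0, T[ u.
  move=> xi ac; apply/subspace_continuousP => -[s0 t0] /=; rewrite in_itv/= => /andP[t00 _].
  apply/cvgrPdist_lt => e e0.
  have [d d0 dP] := value_arcwise_continuous Lsup L_continuous c0 LC u0b u0u s0 ac t00 e0.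
  apply/nbhs_ballP; exists d => //= -[s t] [/= sd td] /=; rewrite in_itv/= => /andP[tp _].
  exact: dP.
split; first by move=> x t /andP[t0 _]; exact: fU.
  split => //.
  - split; first by apply: arcwise_continuousS cu; exact: subset_itv_oo_co.
    move=> x t /andP[t0 tT] xi [adm xi0] w h ht p.
    have /admissibleP[_ aft] := adm.
    apply: (cost_increasing_superdifferential aft ht) => s /andP[hs st].
    have /andP[h0 _] := ht.
    exact: (value_dpp_shift Lsup L_continuous c0 LC u0b adm h0 hs (ltW st)).
  - split; first by apply: arcwise_continuousS cu; exact: subset_itv_oo_co.
    move=> x t /andP[t0 tT] e e0.
    have [xi [adm xi0] xiv] := value_adherent Lsup L_continuous c0 LC u0b x (ltW t0) e0.
    have /admissibleP[_ aft] := adm.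
    (* This [w] is not [u] along the curve: [w] plus the cost is constant, which settles the
       subdifferential inequality, and near-minimality of [xi] keeps [w] above [u - e]. *)
    exists xi, (fun h => u x t - cost H xi h); split => //.
    + apply: within_continuousB; first by apply: continuous_subspaceT => y; exact: cvg_cst.
      apply: continuous_subspaceW (cost_continuous aft (ltW t0)).
      exact: subset_itv_co_cc.
    + by rewrite cost0 subr0.
    + move=> h /andP[h0 ht].
      have := value_shift Lsup L_continuous c0 LC u0b adm h0 (ltW ht).
      by move: xiv; rewrite -[fine _]/(value H u0 (xi h) (t - h)) /u; lra.
    + move=> h ht p; apply: (cost_decreasing_subdifferential aft ht) => s _.
      by lra.
  - by move=> x; apply: (value0 Lsup L_continuous c0 LC u0b).
move=> v [cv [_ vsub] [_ vsup] v0] x t /andP[]; rewrite le_eqVlt => /predU1P[<- _|t0 tT].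
  by rewrite v0; apply/esym/(value0 Lsup L_continuous c0 LC u0b).
have along (xi : R -> X) (A : set R) : admissible H xi -> A `<=` `[0, t] ->
    {within A, continuous (fun h => v (xi h) (t - h))}.
  move=> adm At; apply: (arcwise_continuous_along cv adm) => h /At.
  by rewrite /= !in_itv/= => /andP[h0 ht]; rewrite subr_ge0 h0 ht; split => //; lra.
rewrite -/(value H u0 x t); apply/eqP; rewrite eq_le; apply/andP; split.
  (* For [v <= U], the subsolution property is applied along a near-minimizer of [U]. *)
  apply/ler_addgt0Pr => e e0.
  have [xi [adm xi0] xiv] := value_adherent Lsup L_continuous c0 LC u0b x (ltW t0) e0.
  have /admissibleP[_ aft] := adm.
  apply: le_trans (ltW xiv); rewrite addrC -v0 -[X in v (xi t) X](subrr t).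
  apply: (@le_within_endpoint _ (fun h => v (xi h) (t - h) + cost H xi h)) => //.
    apply: within_continuousD; first exact: along.
    exact: cost_continuous aft (ltW t0).
  move=> h ht.
  have := superdifferential_cost_increasing aft
    (along _ _ adm (@subset_itv_co_cc _ _ _ _))
    (vsub x t (introT andP (conj t0 tT)) xi (conj adm xi0)) ht.
  by rewrite xi0 subr0.
(* For [U <= v], the curve supplied by the supersolution property competes in the infimum. *)
apply/ler_addgt0Pr => e e0.
have [xi [w [[adm xi0] cw w0 wv wsub]]] := vsup x t (introT andP (conj t0 tT)) e e0.
have /admissibleP[_ aft] := adm.
have := value_le Lsup L_continuous c0 LC u0b adm (ltW t0); rewrite xi0 => /le_trans; apply.
rewrite addrC -v0 -[X in v (xi t) X](subrr t) -lerN2.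
apply: (@le_within_endpoint _ (fun h => - (v (xi h) (t - h) + cost H xi h))) => //.
  have -> : (fun h => - (v (xi h) (t - h) + cost H xi h)) =
    (fun=> 0) - (fun h => v (xi h) (t - h) + cost H xi h).
    by apply/funext => h; rewrite /= sub0r.
  apply: within_continuousB; first by apply: continuous_subspaceT => y; exact: cvg_cst.
  apply: within_continuousD; first exact: along.
  exact: cost_continuous aft (ltW t0).
move=> h ht; have := subdifferential_cost_decreasing aft cw wsub ht.
by have := wv h ht; rewrite w0; lra.
Qed.
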